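(* Let $\alpha\in(0,1]$, $\sigma,\eta>0$, $f\in H^1(\mathbb{R})$, and let $v(t,\cdot)$ be the inverse Fourier transform of $\hat v(t,\xi)=\hat f(\xi)\,\mathcal{E}_\alpha(t,\xi)$. Then the map $t\mapsto v(t,\cdot)$ is continuous in $H^1(\mathbb{R})$ up to the initial time $t=0$: $$\lim_{t\to0^+}\|v(t,\cdot)-f\|_{H^1(\mathbb{R})}=0.$$
   Context: $\hat f(\xi)=\int_{\mathbb{R}}e^{-i\xi x}f(x)\,dx$. For each $\xi\in\mathbb{R}$, $t\mapsto\mathcal{E}_\alpha(t,\xi)$ is the solution of $$(\sigma/\eta)D^\alpha_t\mathcal{E}_\alpha(t,\xi)+D^{2\alpha}_t\mathcal{E}_\alpha(t,\xi)=-\xi^2\mathcal{E}_\alpha(t,\xi),\quad t>0,\qquad \mathcal{E}_\alpha(0,\xi)=1,$$ with in addition $\partial_t\mathcal{E}_\alpha(0,\xi)=0$ if $\alpha\in(1/2,1]$; equivalently, it is the continuous function of $t$ with Laplace transform $$\int_0^\infty e^{-\lambda t}\mathcal{E}_\alpha(t,\xi)\,dt=\frac{\lambda^{\alpha-1}(\lambda^\alpha+\sigma/\eta)}{\lambda^\alpha(\sigma/\eta+\lambda^\alpha)+\xi^2},\qquad \lambda>0.$$ Thus $v$ is the solution of the fractional telegraph equation $(\sigma/\eta)D^\alpha_tv+D^{2\alpha}_tv=\partial_x^2v$ on $(0,\infty)\times\mathbb{R}$ with $v(0,\cdot)=f$ (and $\partial_tv(0,\cdot)=0$ if $\alpha\in(1/2,1]$).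 Here $D^\nu_t$ is the Caputo-Dzhrbashyan derivative: for $\nu\in(0,1)\cup(1,2)$, $n=\lceil\nu\rceil$, $D^\nu_t\varphi(t)=\frac{1}{\Gamma(n-\nu)}\int_0^t\varphi^{(n)}(s)(t-s)^{n-\nu-1}ds$; $D^1_t=\frac{d}{dt}$, $D^2_t=\frac{d^2}{dt^2}$. The $H^1$ norm is $\|g\|_{H^1(\mathbb{R})}^2=\int_{\mathbb{R}}(1+\xi^2)|\hat g(\xi)|^2d\xi$ (up to a constant). *)

(* Defs.v *)
From HB Require Import structures.
From mathcomp Require Import all_boot all_order all_algebra.
From mathcomp Require Import all_classical all_reals all_analysis.
From mathcomp Require Import complex.

Set Implicit Arguments.
Unset Strict Implicit.
Unset Printing Implicit Defensive.
Import Order.TTheory GRing.Theory Num.Theory.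
Import numFieldNormedType.Exports.

Local Open Scope classical_set_scope.
Local Open Scope ring_scope.
Local Open Scope complex_scope.

Section Fourier.
Context {R : realType}.
Local Notation mu := (@lebesgue_measure R).

Definition cintegral (D : set R) (g : R -> R[i]) : R[i] :=
  (\int[mu]_(x in D) complex.Re (g x)) +i* (\int[mu]_(x in D) complex.Im (g x)).

Definition sqnorm (z : R[i]) : R := complex.Re z ^+ 2 + complex.Im z ^+ 2.

Definition L2 (g : R -> R[i]) : Prop :=
  [/\ measurable_fun setT (fun x => complex.Re (g x)),
      measurable_fun setT (fun x => complex.Im (g x)) &
      (\int[mu]_x (sqnorm (g x))%:E < +oo)%E].

Definition fourier_trunc (g : R -> R[i]) (N : nat) (xi : R) : R[i] :=
  cintegral `[- N%:R, N%:R] (fun x => (cos (xi * x) -i* sin (xi * x)) * g x).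

(* [is_fourier g G]: [G] is (a representative of) the Fourier-Plancherel
   transform of [g], i.e. the L2 limit of the integrals of e^{-i xi x} g(x)
   over [-N, N] (these need not converge absolutely over the line).  Read from
   right to left, it says that [g] is the inverse Fourier transform of [G]. *)
Definition is_fourier (g G : R -> R[i]) : Prop :=
  [/\ L2 g, L2 G &
      (\int[mu]_xi (sqnorm (fourier_trunc g N xi - G xi))%:E)%E
        @[N --> \oo] --> 0%E].

(* By Plancherel's theorem a transform exists for every [g] in L2, and it is
   unique almost everywhere; the default value [cst 0] is used outside L2. *)
Definition fourier (g : R -> R[i]) : R -> R[i] :=
  xget (cst 0) [set G | is_fourier g G].

Definition H1norm (g : R -> R[i]) : \bar R :=
  ((\int[mu]_xi ((1 + xi ^+ 2) * sqnorm (fourier g xi))%:E) `^ 2^-1)%E.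

Definition H1 (g : R -> R[i]) : Prop :=
  is_fourier g (fourier g) /\ (H1norm g < +oo)%E.

End Fourier.

Section Caputo.
Context {R : realType}.
Local Notation mu := (@lebesgue_measure R).

Definition Gamma (a : R) : R :=
  \int[mu]_(s in `]0, +oo[) (s `^ (a - 1) * expR (- s)).

Definition ceiln (nu : R) : nat := `|Num.ceil nu|%N.

Definition caputo (nu : R) (phi : R -> R) (t : R) : R :=
  let n := ceiln nu in
  if nu == n%:R then derive1n n phi t
  else (Gamma (n%:R - nu))^-1 *
       \int[mu]_(s in `]0, t[) (derive1n n phi s * (t - s) `^ (n%:R - nu - 1)).

(* [phi] solves kappa D^alpha phi + D^(2 alpha) phi = - xi^2 phi on t > 0 with
   phi(0) = 1, and phi'(0+) = 0 when 1/2 < alpha.  The three regularity fields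
   make all the Caputo derivatives involved meaningful: for n the ceiling of
   2 alpha, phi is C^n on ]0, +oo[ and phi^(n) is integrable near 0 (it is in
   general unbounded there, of order t^(2 alpha - n)).  Values of [phi] at
   negative times are irrelevant. *)
Record telegraph_sol (alpha kappa xi : R) (phi : R -> R) : Prop := {
  tsol_continuous : {within `[0, +oo[, continuous phi} ;
  tsol_derivable : forall (k : nat) (t : R),
    (k < ceiln (2 * alpha))%N -> 0 < t -> derivable (derive1n k phi) t 1 ;
  tsol_continuous_derivn : forall t : R,
    0 < t -> {for t, continuous (derive1n (ceiln (2 * alpha)) phi)} ;
  tsol_integrable : forall T : R,
    0 < T -> mu.-integrable `]0, T[ (EFin \o derive1n (ceiln (2 * alpha)) phi) ;
  tsol_eq : forall t : R, 0 < t ->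
    kappa * caputo alpha phi t + caputo (2 * alpha) phi t = - xi ^+ 2 * phi t ;
  tsol_init : phi 0 = 1 ;
  tsol_init' : 2^-1 < alpha ->
    (h^-1 * (phi h - phi 0)) @[h --> 0^'+] --> (0 : R)
}.

End Caputo.

(* Main.v *)
Require Import Defs.
From HB Require Import structures.
From mathcomp Require Import all_boot all_order all_algebra.
From mathcomp Require Import all_classical all_reals all_analysis.
From mathcomp Require Import complex.
From mathcomp Require Import measurable_realfun ring lra.

Set Implicit Arguments.
Unset Strict Implicit.
Unset Printing Implicit Defensive.
Import Order.TTheory GRing.Theory Num.Theory.
Import numFieldNormedType.Exports.

Local Open Scope classical_set_scope.
Local Open Scope ring_scope.
Local Open Scope complex_scope.

(** Everything rests on the bound |E(t, xi)| <= 1 for xi <> 0: by Plancherel the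
    H1 norm is a weighted L2 norm of the transform, so continuity in t then
    follows by dominated convergence from the pointwise continuity of E(., xi).

    Put phi = E(., xi).  For alpha <= 1/2 both Caputo derivatives have order at
    most 1, and they are nonnegative at a maximum of phi on [0, t]; since
    - xi^2 phi < 0 at a positive maximum, phi cannot exceed its initial value 1,
    and dually for - phi.

    For alpha > 1/2 one multiplies the equation by psi = phi' and integrates: with
    k_nu(t) = t^(-nu), both int_0^T psi (k_alpha * psi) and
    int_0^T psi (k_(2 alpha - 1) * psi') are nonnegative (psi vanishes at 0), which
    leaves xi^2 (phi(T)^2 - 1) <= 0.

    In both cases the singular kernel is handled by writing t^(-nu) as a positive
    mixture of exponentials, t^(-nu) = c int_0^oo exp(- p^(1/nu) t) dp, because for
    exponential kernels positivity is the fundamental theorem of calculus. *)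

(** * The fundamental theorem of calculus with singular endpoints *)

(** Two arguments are needed because neither covers all alpha. When 2 alpha < 1, phi' is in general
    unbounded at 0, so it cannot serve as a continuous multiplier up to t = 0. When alpha > 1/2, the
    derivative of order 2 alpha no longer has the right sign at a maximum: for alpha = 1 it is
    phi'', which is nonpositive at an interior one. Both arguments leave a factor xi^2 in front, so
    they say nothing at xi = 0; a single frequency is a null set, which is why every domination
    below holds almost everywhere only.

    The technical obstacle is that integrands are singular at both ends: the highest derivative of
    phi is merely integrable near s = 0, and the kernel blows up at s = t. Hence the fundamental
    theorem is needed for primitives continuous on the closed interval with a derivative that is
    only integrable, and each use of Fubini, on integrands of variable sign, must be preceded by a
    proof of absolute integrability.

    The exponent 1/nu in the mixture is chosen for scaling: substituting q = t^nu p pulls out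
    t^(-nu) and leaves a constant, of which only 0 < 1/c < +oo matters. *)

Lemma integrable_derive_ge0 (R : realType) (F f : R -> R) (a b : R) : a < b ->
  {within `[a, b], continuous F} ->
  (forall x, a < x < b -> is_derive x 1 F (f x)) ->
  (forall x, a < x < b -> {for x, continuous f}) ->
  (forall x, a < x < b -> 0 <= f x) ->
  lebesgue_measure.-integrable `]a, b[ (EFin \o f).
Proof.
move=> ab cF dF cf f0.
set mu := lebesgue_measure.
have mf : measurable_fun `]a, b[ f.
  apply: open_continuous_measurable_fun; first exact: interval_open.
  by move=> x; rewrite inE/= in_itv/=; exact: cf.
apply/integrableP; split; first exact/measurable_EFinP.
(* The factor 1/3 keeps [a + e n < b - e n] for every n, including n = 0, so that each compact
   interval [A n] is nondegenerate. *)
have e0 (n : nat) : 0 < (b - a) / 3 / n.+1%:R.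
  by rewrite !divr_gt0// ?subr_gt0.
pose e n := (b - a) / 3 / n.+1%:R : R.
have elt n : e n <= (b - a) / 3.
  rewrite /e ler_pdivrMr ?ltr0n// ler_peMr ?ler1n//.
  by rewrite divr_ge0// ltW// subr_gt0.
pose A n := `[a + e n, b - e n]%classic : set R.
have AE : `]a, b[%classic = \bigcup_n A n.
  apply/seteqP; split => [x /=|x [n _]]; last first.
    rewrite /A/= !in_itv/= => /andP[x1 x2]; apply/andP; split.
      by rewrite (lt_le_trans _ x1)// ltrDl e0.
    by rewrite (le_lt_trans x2)// gtrBl e0.
  rewrite in_itv/= => /andP[ax xb].
  pose m := Num.min (x - a) (b - x).
  have m0 : 0 < m by rewrite lt_min !subr_gt0 ax xb.
  have [n nm] : exists n, e n <= m.
    exists (Num.truncn ((b - a) / 3 / m)).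
    rewrite /e ler_pdivrMr ?ltr0n// [leRHS]mulrC -ler_pdivrMr//.
    by apply: ltW; exact: truncnS_gt.
  exists n => //; rewrite /A/= in_itv/=.
  move: nm; rewrite /m le_min => /andP[n1 n2].
  by apply/andP; split; lra.
have Aab n : A n `<=` `]a, b[.
  by rewrite AE; exact: bigcup_sup.
have abs_f : (\int[mu]_(x in `]a, b[) `|(EFin \o f) x| = \int[mu]_(x in `]a, b[) (f x)%:E)%E.
  apply: eq_integral => x; rewrite inE/= in_itv/= => xab.
  by rewrite ger0_norm// f0.
rewrite abs_f.
(* The integrals over [A n] are increments of [F], hence at most twice a bound of |F| on [[a, b]];
   monotone convergence transfers this bound to the open interval. *)
have /= cvgA : (\int[mu]_(x in A n) (f x)%:E @[n --> \oo] --> \int[mu]_(x in \bigcup_n A n) (f x)%:E)%E.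
  apply: ge0_nondecreasing_set_cvg_integral.
  - move=> n m nm; apply/subsetPset; apply: subset_itv; rewrite bnd_simp.
      rewrite lerD2l /e ler_pM2l ?divr_gt0 ?subr_gt0// lef_pV2 ?posrE ?ltr0n//.
      by rewrite ler_nat.
    rewrite lerD2l lerN2 /e ler_pM2l ?divr_gt0 ?subr_gt0// lef_pV2 ?posrE ?ltr0n//.
    by rewrite ler_nat.
  - by move=> i; exact: measurable_itv.
  - by move=> i; apply/measurable_EFinP; exact: measurable_funS mf.
  - by move=> i x /Aab/=; rewrite in_itv/= lee_fin; exact: f0.
have FTC n : (\int[mu]_(x in A n) (f x)%:E = (F (b - e n))%:E - (F (a + e n))%:E)%E.
  have e0n := e0 n; have eltn := elt n; rewrite -/(e n) in e0n.
  have lt_ab : a + e n < b - e n by move: (e n) e0n eltn => en *; lra.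
  have inn x : x \in `]a + e n, b - e n[ -> a < x < b.
    by rewrite in_itv/= => /andP[]; move: (e n) e0n eltn => en *; lra.
  have inn' x : x \in `[a + e n, b - e n] -> a < x < b.
    by rewrite in_itv/= => /andP[]; move: (e n) e0n eltn => en *; lra.
  have cFA : {within `[a + e n, b - e n], continuous F}.
    by apply: continuous_subspaceW cF => x /= /inn'; rewrite in_itv/= => /andP[*]; rewrite !ltW.
  apply: continuous_FTC2 => //.
  - apply: continuous_in_subspaceT => x; rewrite inE => /inn'; exact: cf.
  - split.
    + by move=> x /inn /dF /@ex_derive.
    + by case/(continuous_within_itvP _ lt_ab): cFA.
    + by case/(continuous_within_itvP _ lt_ab): cFA.
  - by move=> x /inn /dF dFx; rewrite derive1E derive_val.
have [M [_ hM]] : bounded_set (F @` `[a, b]).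
  apply: compact_bounded; apply: continuous_compact => //; exact: segment_compact.
have FM x : a <= x <= b -> `|F x| <= `|M| + 1.
  move=> xab; apply: (hM (`|M| + 1)); first by rewrite (le_lt_trans (ler_norm _))// ltrDl.
  by exists x.
rewrite AE; apply: (@le_lt_trans _ _ ((`|M| + 1 + (`|M| + 1))%:E)%E); last by rewrite ltry.
rewrite -(cvg_lim _ cvgA)//; apply: lime_le; first by apply/cvg_ex; eexists; exact: cvgA.
apply: nearW => n; rewrite FTC -EFinB lee_fin.
have e0n := e0 n; have eltn := elt n; rewrite -/(e n) in e0n.
have := FM (b - e n); have := FM (a + e n).
move: (e n) e0n eltn => en *.
have h1 : a <= a + en <= b by lra.
have h2 : a <= b - en <= b by lra.
rewrite (le_trans (ler_norm _))// (le_trans (ler_normB _ _))//.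
by rewrite lerD//; auto.
Qed.

Lemma integrable_itv_oo_cc (R : realType) (f : R -> R) (a b : R) :
  lebesgue_measure.-integrable `]a, b[ (EFin \o f) ->
  lebesgue_measure.-integrable `[a, b] (EFin \o f).
Proof.
move=> /integrableP[/measurable_EFinP mf ltf]; apply/integrableP; split.
  apply/measurable_EFinP; exact: measurable_fun_itv_cc mf.
rewrite -integral_itv_bndo_bndc.
  rewrite -integral_itv_obnd_cbnd//.
  by apply: measurableT_comp => //; apply/measurable_EFinP.
apply: measurableT_comp => //.
apply/measurable_EFinP; exact: measurable_fun_itv_co mf.
Qed.

(** Since [f] may blow up at both ends, [F] is compared with the indefinite integral of [f]: both
    are continuous on [[a, b]] with derivative [f] inside, so by the mean value theorem they differ
    by a constant. *)
Lemma FTC2_integrable (R : realType) (F f : R -> R) (a b : R) : a < b ->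
  {within `[a, b], continuous F} ->
  (forall x, a < x < b -> is_derive x 1 F (f x)) ->
  (forall x, a < x < b -> {for x, continuous f}) ->
  lebesgue_measure.-integrable `]a, b[ (EFin \o f) ->
  \int[lebesgue_measure]_(x in `]a, b[) f x = F b - F a.
Proof.
move=> ab cF dF cf intf.
set mu := lebesgue_measure.
have mf : measurable_fun `]a, b[ (EFin \o f) by exact: measurable_int intf.
have mf' : measurable_fun `]a, b[ f by exact/measurable_EFinP.
have intfc := integrable_itv_oo_cc intf.
pose G x := parameterized_integral mu a x f.
have cG : {within `[a, b], continuous G}.
  by apply: parameterized_integral_continuous => //; exact: ltW.
have dG x : a < x < b -> is_derive x 1 G (f x).
  move=> /andP[ax xb]; have [] := @continuous_FTC1 R f (BLeft a) x b xb intfc.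
    exact: ax.
    by apply: cf; rewrite ax xb.
  by move=> dGx G'; apply: (DeriveDef dGx); rewrite -derive1E.
have : exists2 c, c \in `]a, b[ & (F \- G) b - (F \- G) a = 0 * (b - a).
  apply: (@MVT R (F \- G) (fun=> 0) a b ab).
    move=> x; rewrite in_itv/= => xab.
    have := is_deriveB (dF _ xab) (dG _ xab).
    by rewrite subrr.
  apply/subspace_continuousP => x xab; apply: cvgB.
    by move/subspace_continuousP : cF; exact.
  by move/subspace_continuousP : cG; exact.
move=> [c _]; rewrite mul0r /= => /eqP.
have Ga : G a = 0 by rewrite /G /parameterized_integral set_itv1 Rintegral_set1.
rewrite Ga subr0 subr_eq0 => /eqP FG.
have -> : \int[mu]_(x in `]a, b[) f x = G b.
  rewrite /G /parameterized_integral /Rintegral.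
  rewrite -integral_itv_bndo_bndc.
    by rewrite -integral_itv_obnd_cbnd.
  apply/measurable_EFinP; exact: measurable_fun_itv_co mf'.
by rewrite -FG; ring.
Qed.

(** * Power kernels as mixtures of exponentials *)

(** For a > 0 its value is Gamma(1 + 1/a), but only its positivity and finiteness are used. *)
Definition stretched_integral (R : realType) (a : R) : \bar R :=
  (\int[lebesgue_measure]_(q in `[0%R, +oo[) (expR (- (q `^ a)))%:E)%E.

Lemma cvg_powR0 (R : realType) (T : Type) (F : set_system T) (f : T -> R) (p : R) :
  Filter F -> 0 < p -> (\forall x \near F, 0 <= f x) ->
  f x @[x --> F] --> 0 -> f x `^ p @[x --> F] --> 0.
Proof.
move=> FF p0 f0 /cvgrPdist_lt f_cvg0; apply/cvgrPdist_le => e e0.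
have ep0 : 0 < e `^ p^-1 by rewrite powR_gt0.
apply: filterS2 (f_cvg0 _ ep0) f0 => x; rewrite !sub0r !normrN => fx f0x.
rewrite ger0_norm ?powR_ge0//.
have -> : e = (e `^ p^-1) `^ p by rewrite -powRrM mulVf ?powRr1 ?gt_eqF// ltW.
by rewrite ge0_ler_powR ?nnegrE ?powR_ge0 ?(ltW p0)// (le_trans (ler_norm _))// ltW.
Qed.

Lemma continuous_stretched (R : realType) (a : R) : 0 < a ->
  {within `[0, +oo[, continuous (fun q : R => expR (- (q `^ a)))}.
Proof.
move=> a0; apply/continuous_within_itvcyP; split.
  move=> x; rewrite in_itv/= andbT => x0.
  apply: continuous_cvg; first exact: continuous_expR.
  apply: cvgN; have /@ex_derive/derivable1_diffP := is_derive1_powR a x0.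
  exact: differentiable_continuous.
apply: continuous_cvg; first exact: continuous_expR.
apply: cvgN; rewrite powR0 ?gt_eqF//; apply: cvg_powR0 => //.
  by near=> x; near: x; exact: nbhs_right_ge.
exact/cvg_at_right_filter.
Unshelve. all: by end_near. Qed.

Lemma stretched_integral_gt0 (R : realType) (a : R) : 1 <= a ->
  (0 < stretched_integral a)%E.
Proof.
move=> a1.
apply: (@lt_le_trans _ _ (\int[lebesgue_measure]_(q in `[0%R, 1%R]) (expR (- 1))%:E)%E).
  rewrite integral_cst//= lebesgue_measure_itv/= lte01 -EFinB subr0 mule1.
  by rewrite lte_fin expR_gt0.
have mf (A : set R) : measurable_fun A (fun q : R => expR (- (q `^ a))).
  apply: measurableT_comp => //; apply: measurableT_comp => //.
  by apply: measurable_funTS; exact: measurable_powR.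
apply: (@le_trans _ _ (\int[lebesgue_measure]_(q in `[0%R, 1%R]) (expR (- (q `^ a)))%:E)%E).
  apply: ge0_le_integral => //.
  - apply/measurable_EFinP; exact: mf.
  - move=> x /=; rewrite in_itv/= => /andP[x0 x1].
    rewrite lee_fin ler_expR lerN2.
    have : x `^ a <= 1 `^ a by rewrite ge0_ler_powR ?nnegrE// (le_trans _ a1).
    by rewrite powR1.
apply: ge0_subset_integral => //=.
- apply/measurable_EFinP; exact: mf.
- by move=> x /=; rewrite !in_itv/= => /andP[->].
Qed.

(** For a >= 1 one has q - 1 <= q^a on q >= 0, so the integrand is at most e times the exponential
    density of rate 1. *)
Lemma stretched_integral_lty (R : realType) (a : R) : 1 <= a ->
  (stretched_integral a < +oo)%E.
Proof.
move=> a1.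
have mf (A : set R) : measurable_fun A (fun q : R => expR (- (q `^ a))).
  apply: measurableT_comp => //; apply: measurableT_comp => //.
  by apply: measurable_funTS; exact: measurable_powR.
apply: (@le_lt_trans _ _ (\int[lebesgue_measure]_(q in `[0%R, +oo[) (expR 1 * exponential_pdf 1 q)%:E)%E).
  apply: ge0_le_integral => //.
  - apply/measurable_EFinP; exact: mf.
  - apply/measurable_EFinP; apply: measurable_funM => //.
    apply: measurable_funTS; exact: measurable_exponential_pdf.
  - move=> x x0; rewrite lee_fin /exponential_pdf patchE mem_set// mul1r -expRD.
    move: x0; rewrite /= in_itv/= andbT => x0.
    rewrite ler_expR.
    suff : x - 1 <= x `^ a by lra.
    have [x1|x1] := leP 1 x.
      by rewrite (le_trans _ (le1r_powR x1 a1))// gerBl.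
    by rewrite (le_trans _ (powR_ge0 _ _))// subr_le0 ltW.
under eq_integral do rewrite EFinM.
rewrite ge0_integralZl//; last 2 first.
  - apply/measurable_EFinP; apply: measurable_funTS; exact: measurable_exponential_pdf.
  - by move=> x _; rewrite lee_fin exponential_pdf_ge0.
apply: lte_mul_pinfty => //.
apply: (@le_lt_trans _ _ 1%E); last by rewrite ltry.
rewrite -(@integral_exponential_pdf R 1 ltr01).
apply: ge0_subset_integral => //=.
- apply/measurable_EFinP; exact: measurable_exponential_pdf.
- by move=> x _; rewrite lee_fin exponential_pdf_ge0.
Qed.

(** The substitution q = tau^nu p turns q^(1/nu) into p^(1/nu) tau; its Jacobian tau^nu accounts for
    the factor tau^(-nu). *)
Lemma powR_mixture (R : realType) (nu tau : R) : 0 < nu -> nu <= 1 -> 0 < tau ->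
  (\int[lebesgue_measure]_(p in `[0%R, +oo[) (expR (- (p `^ nu^-1 * tau)))%:E =
   (tau `^ (- nu))%:E * stretched_integral nu^-1)%E.
Proof.
move=> nu0 nu1 tau0.
have a1 : 1 <= nu^-1 by rewrite invf_ge1.
pose r := tau `^ nu; have r0 : 0 < r by rewrite powR_gt0.
have dF (x : R) : is_derive x 1 (fun p : R => r * p) r.
  by apply: is_derive_eq; exact: mulr1.
have F' : (fun p : R => r * p)^`()%classic = cst r.
  by apply/funext => x; rewrite derive1E derive_val.
rewrite /stretched_integral.
have /= := @increasing_ge0_integration_by_substitutiony R (fun p => r * p)
  (fun q => expR (- (q `^ nu^-1))) 0.
rewrite mulr0 => ->; last 8 first.
- by move=> x y _ _ xy; rewrite ltr_pM2l.
- by rewrite F' => x _; exact: cvg_cst.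
- by rewrite F'; exact: is_cvg_cst.
- by rewrite F'; exact: is_cvg_cst.
- split; first by move=> x _; exact: ex_derive.
  apply/cvg_at_right_filter; apply: cvgM; [exact: cvg_cst|exact: cvg_id].
- by apply: gt0_cvgMry => //; exact: cvg_id.
- by apply: continuous_stretched; rewrite invr_gt0.
- by move=> x _; exact: expR_ge0.
rewrite F' -ge0_integralZl//; last 3 first.
- apply/measurable_EFinP; apply: measurable_funM => //.
  apply: measurableT_comp => //; apply: measurableT_comp => //.
  by apply: measurableT_comp => //; exact: measurable_powR.
- by move=> x _; rewrite lee_fin mulr_ge0 ?expR_ge0// ltW.
- by rewrite lee_fin powR_ge0.
apply: eq_integral => x; rewrite inE/= in_itv/= andbT => x0.
rewrite -EFinM; congr EFin.
rewrite -[(_ * cst r) x]/(expR (- (r * x) `^ nu^-1) * r) mulrCA powRN mulVf ?mulr1; last by rewrite gt_eqF.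
by rewrite powRM ?(ltW r0)// -powRrM mulfV ?gt_eqF// powRr1 ?(ltW tau0)// [in RHS]mulrC.
Qed.

(** Transfers positivity from exponential kernels to the power kernel. By Fubini, the integral of h
    tau^(-nu) times a positive constant is an integral over p >= 0 of integrals of h against exp(-
    lam tau) with lam = p^(1/nu). The space is abstract because it is the plane in the energy
    estimate and the line in the maximum principle. *)
Lemma kernel_mixture d (X : measurableType d) (R : realType)
    (m : {sigma_finite_measure set X -> \bar R}) (h tau : X -> R) (nu : R) :
  0 < nu -> nu <= 1 ->
  measurable_fun setT h -> measurable_fun setT tau ->
  (forall x, h x != 0 -> 0 < tau x) ->
  m.-integrable setT (fun x => (h x * tau x `^ (- nu))%:E) ->
  (forall lam, 0 <= lam -> (0 <= \int[m]_x (h x * expR (- (lam * tau x)))%:E)%E) ->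
  (0 <= \int[m]_x (h x * tau x `^ (- nu))%:E)%E.
Proof.
move=> nu0 nu1 mh mtau tau0 inth hpos.
have a1 : 1 <= nu^-1 by rewrite invf_ge1.
set c := stretched_integral (nu^-1).
have c0 : (0 < c)%E := stretched_integral_gt0 a1.
have cy : (c < +oo)%E := stretched_integral_lty a1.
have cfin : c \is a fin_num by rewrite ge0_fin_numE// ltW.
pose mu := @lebesgue_measure R.
(* Cutting off at p < 0 lets the second variable range over the whole line, as the product measure
   requires. *)
pose e (x : X) (p : R) : R := (if 0 <= p then expR (- (p `^ nu^-1 * tau x)) else 0).
pose f (z : X * R) : \bar R := (h z.1 * e z.1 z.2)%:E.
have int_e x : 0 < tau x -> (\int[mu]_p (e x p)%:E = (tau x `^ (- nu))%:E * c)%E.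
  move=> t0; rewrite -powR_mixture// [RHS]integral_mkcond/=.
  apply: eq_integral => p _; rewrite patchE /e.
  have [p0|p0] := leP 0 p; first by rewrite mem_set//= in_itv/= p0.
  by rewrite memNset//= in_itv/= andbT; apply/negP; rewrite -ltNge.
have me : measurable_fun setT (fun z : X * R => e z.1 z.2).
  apply: measurable_fun_ifT => //.
  - exact: measurable_fun_ler.
  - apply: measurableT_comp => //; apply: measurableT_comp => //; apply: measurable_funM.
      exact: (measurableT_comp (measurable_powR (nu^-1)) measurable_snd).
    by apply: measurableT_comp.
have me1 x : measurable_fun setT (e x).
  by have := measurableT_comp me (measurable_pair1 x).
have mf : measurable_fun setT f.
  apply/measurable_EFinP; apply: measurable_funM => //.
  exact: measurableT_comp.
have e0 x p : 0 <= e x p by rewrite /e; case: ifP => // _; exact: expR_ge0.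
(* By Tonelli, integrating |f| in p first gives c |h| tau^(-nu), integrable by assumption; this
   justifies Fubini although [h] changes sign. *)
have intf : (m \x mu)%E.-integrable setT f.
  apply/integrable12ltyP => //=.
  rewrite (eq_integral (fun x => (`|(h x * tau x `^ (- nu))%:E| * c)%E)); last first.
    move=> x _; have [hx|hx] := eqVneq (h x) 0.
      rewrite hx mul0r ?normr0 ?abse0 mul0e; apply: integral0_eq => p _.
      by rewrite /f/= ?hx mul0r ?normr0 ?abse0.
    under eq_integral do rewrite /f/= normrM (ger0_norm (e0 _ _)) EFinM.
    rewrite ge0_integralZl//; last 2 first.
      (apply/measurable_EFinP; exact: me1).
      by move=> p _; rewrite lee_fin.
    by rewrite int_e ?tau0//= normrM EFinM (ger0_norm (powR_ge0 _ _)) muleA.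
  rewrite ge0_integralZr//; last 2 first.
    apply: measurableT_comp => //; exact: measurable_int inth.
    exact: ltW.
  rewrite muleC lte_mul_pinfty//; first exact: ltW.
  by case/integrableP : inth.
have key : (0 <= \int[m]_x \int[mu]_p f (x, p))%E.
  rewrite (Fubini intf); apply: integral_ge0 => p _; rewrite /f/= /e.
  have [p0|p0] := leP 0 p; last first.
    by rewrite integral0_eq// => x _; rewrite mulr0.
  exact/hpos/powR_ge0.
have : (\int[m]_x \int[mu]_p f (x, p) = \int[m]_x ((h x * tau x `^ (- nu))%:E * c))%E.
  apply: eq_integral => x _; have [hx|hx] := eqVneq (h x) 0.
    rewrite hx mul0r mul0e; apply: integral0_eq => p _.
    by rewrite /f/= hx mul0r.
  rewrite /f/=; under eq_integral do rewrite EFinM.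
  rewrite integralZl//; first by rewrite int_e ?tau0// EFinM muleA.
  apply/integrableP; split; first (apply/measurable_EFinP; exact: me1).
  under eq_integral do rewrite /= ger0_norm ?e0//.
  by rewrite int_e ?tau0// lte_mul_pinfty// lee_fin powR_ge0.
move=> keyE; move: key; rewrite keyE -(fineK cfin) integralZr//.
by rewrite pmule_lge0// lte_fin fine_gt0// c0 cy.
Qed.

(** As 1 - nu > 0, these primitives stay continuous at the singular endpoint, which puts both
    one-sided kernels within reach of [integrable_derive_ge0] and [FTC2_integrable]. *)
Lemma powR_primitives (R : realType) (a b nu : R) : a < b -> nu < 1 ->
  [/\ {within `[a, b], continuous (fun t => (t - a) `^ (1 - nu) / (1 - nu))},
      {within `[a, b], continuous (fun t => - ((b - t) `^ (1 - nu) / (1 - nu)))},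
      forall t, a < t < b ->
        is_derive t 1 (fun t => (t - a) `^ (1 - nu) / (1 - nu)) ((t - a) `^ (- nu)),
      forall t, a < t < b ->
        is_derive t 1 (fun t => - ((b - t) `^ (1 - nu) / (1 - nu))) ((b - t) `^ (- nu)) &
      (forall t, a < t -> {for t, continuous (fun t => (t - a) `^ (- nu))}) /\
      (forall t, t < b -> {for t, continuous (fun t => (b - t) `^ (- nu))})].
Proof.
move=> ab nu1; have p0 : 0 < 1 - nu by rewrite subr_gt0.
have pn0 : 1 - nu != 0 by rewrite gt_eqF.
have dl q t : a < t -> is_derive t 1 (fun t => (t - a) `^ q) (q * (t - a) `^ (q - 1)).
  move=> at0; have t0 : 0 < t - a by rewrite subr_gt0.
  have h := is_derive1_powR q t0.
  have := @is_derive1_comp _ (@powR R ^~ q) (fun t => t - a) t _ 1 h.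
  rewrite mulr1; apply; apply: is_derive_eq; exact: subr0.
have dr q t : t < b -> is_derive t 1 (fun t => (b - t) `^ q) (- (q * (b - t) `^ (q - 1))).
  move=> tb; have t0 : 0 < b - t by rewrite subr_gt0.
  have h := is_derive1_powR q t0.
  have := @is_derive1_comp _ (@powR R ^~ q) (fun t => b - t) t _ (-1) h.
  by rewrite mulrN1; apply; apply: is_derive_eq; rewrite add0r mul1r.
have dl1 t : a < t -> is_derive t 1 (fun t => (t - a) `^ (1 - nu) / (1 - nu)) ((t - a) `^ (- nu)).
  move=> at0; have d := dl (1 - nu) t at0.
  have -> : (fun t => (t - a) `^ (1 - nu) / (1 - nu)) = (1 - nu)^-1 \*: (fun t => (t - a) `^ (1 - nu)).
    by apply/funext => s /=; rewrite mulrC.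
  apply: is_derive_eq; rewrite /GRing.scale/= mulKf//; congr (_ `^ _); ring.
have dr1 t : t < b -> is_derive t 1 (fun t => - ((b - t) `^ (1 - nu) / (1 - nu))) ((b - t) `^ (- nu)).
  move=> at0; have d := dr (1 - nu) t at0.
  have -> : (fun t => - ((b - t) `^ (1 - nu) / (1 - nu))) =
      (- (1 - nu)^-1) \*: (fun t => (b - t) `^ (1 - nu)).
    by apply/funext => s /=; rewrite -mulNr mulrC /GRing.scale/= mulrN mulNr.
  apply: is_derive_eq; rewrite /GRing.scale/= mulrNN mulKf//; congr (_ `^ _); ring.
have dc (f : R -> R) (t df : R) : is_derive t 1 f df -> {for t, continuous f}.
  by move=> /@ex_derive/derivable1_diffP/differentiable_continuous.
split.
- apply/continuous_within_itvP => //; split.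
  + by move=> t; rewrite in_itv/= => /andP[at_ _]; exact: dc (dl1 _ at_).
  + rewrite subrr powR0// mul0r; rewrite -[X in _ --> X](mul0r (1 - nu)^-1).
    apply: cvgM; last exact: cvg_cst.
    apply: cvg_powR0 => //.
      by near=> t; rewrite subr_ge0; near: t; exact: nbhs_right_ge.
    rewrite -[X in _ --> X](subrr a); apply/cvg_at_right_filter.
    by apply: cvgB; [exact: cvg_id|exact: cvg_cst].
  + by apply/cvg_at_left_filter; exact: dc (dl1 _ ab).
- apply/continuous_within_itvP => //; split.
  + by move=> t; rewrite in_itv/= => /andP[_ tb]; exact: dc (dr1 _ tb).
  + by apply/cvg_at_right_filter; exact: dc (dr1 _ ab).
  + rewrite subrr powR0//; apply: cvgN.
    apply: cvgM; last exact: cvg_cst.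
    apply: cvg_powR0 => //.
      by near=> t; rewrite subr_ge0; near: t; exact: nbhs_left_le.
    rewrite -[X in _ --> X](subrr b); apply/cvg_at_left_filter.
    by apply: cvgB; [exact: cvg_cst|exact: cvg_id].
- by move=> t /andP[at_ _]; exact: dl1.
- by move=> t /andP[_ tb]; exact: dr1.
- split=> t tb; first exact: dc (dl _ _ tb).
  exact: dc (dr _ _ tb).
Unshelve. all: by end_near. Qed.

Lemma integral_powR_left (R : realType) (a b nu : R) : a < b -> nu < 1 ->
  lebesgue_measure.-integrable `]a, b[ (EFin \o (fun t => (t - a) `^ (- nu))) /\
  \int[lebesgue_measure]_(t in `]a, b[) ((t - a) `^ (- nu)) = (b - a) `^ (1 - nu) / (1 - nu).
Proof.
move=> ab nu1; have [cl _ dl _ [ccl _]] := powR_primitives ab nu1.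
have cc t : a < t < b -> {for t, continuous (fun t => (t - a) `^ (- nu))}.
  by move=> /andP[at_ _]; exact: ccl.
have I : lebesgue_measure.-integrable `]a, b[ (EFin \o (fun t => (t - a) `^ (- nu))).
  by apply: (integrable_derive_ge0 ab cl dl cc) => t _; exact: powR_ge0.
split => //; rewrite (FTC2_integrable ab cl dl cc I).
by rewrite subrr powR0 ?mul0r ?subr0// gt_eqF// subr_gt0.
Qed.

Lemma integrable_powR_right (R : realType) (a b nu : R) : a < b -> nu < 1 ->
  lebesgue_measure.-integrable `]a, b[ (EFin \o (fun t => (b - t) `^ (- nu))).
Proof.
move=> ab nu1; have [_ cr _ dr [_ ccr]] := powR_primitives ab nu1.
have cc t : a < t < b -> {for t, continuous (fun t => (b - t) `^ (- nu))}.
  by move=> /andP[_ tb]; exact: ccr.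
by apply: (integrable_derive_ge0 ab cr dr cc) => t _; exact: powR_ge0.
Qed.

(** The two singularities sit at opposite ends, [g] at 0 and the kernel at t. Left of t / 2 the
    kernel is at most (t / 2)^(-nu); right of it [g] is bounded by compactness. The dominating [G]
    is the sum of the two resulting bounds. *)
Lemma integrable_convolution (R : realType) (g : R -> R) (t nu : R) :
  0 < t -> 0 <= nu -> nu < 1 ->
  lebesgue_measure.-integrable `]0, t[ (EFin \o g) ->
  (forall s, 0 < s <= t -> {for s, continuous g}) ->
  lebesgue_measure.-integrable `]0, t[ (EFin \o (fun s => g s * (t - s) `^ (- nu))).
Proof.
move=> t0 nu0 nu1 ig cg.
have [M [_ hM]] : bounded_set (g @` `[t / 2, t]).
  apply: compact_bounded; apply: continuous_compact; last exact: segment_compact.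
  apply: continuous_in_subspaceT => s; rewrite inE/= in_itv/= => /andP[s1 s2].
  by apply: cg; rewrite s2 andbT; lra.
have gM s : t / 2 <= s <= t -> `|g s| <= `|M| + 1.
  move=> st; apply: (hM (`|M| + 1)); first by rewrite (le_lt_trans (ler_norm _))// ltrDl.
  by exists s.
have mk (A : set R) : measurable_fun A (fun s : R => (t - s) `^ (- nu)).
  apply: (@measurableT_comp _ _ _ _ _ _ (@powR R ^~ (- nu))); first exact: measurable_powR.
  by apply: measurable_funB.
pose G (s : R) := (t / 2) `^ (- nu) * `|g s| + (`|M| + 1) * (t - s) `^ (- nu).
have iG : lebesgue_measure.-integrable `]0, t[ (EFin \o G).
  rewrite (_ : EFin \o G = (fun s => ((t / 2) `^ (- nu))%:E * (EFin \o (fun s => `|g s|%R)) s +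
      (`|M| + 1)%:E * (EFin \o (fun s => (t - s)%R `^ (- nu)%R)%R) s)%E)//.
  apply: integrableD => //; apply: integrableZl => //.
    exact: integrable_abse ig.
  exact: integrable_powR_right.
apply: le_integrable iG => //.
  apply/measurable_EFinP; apply: measurable_funM; last exact: mk.
  by apply/measurable_EFinP; exact: measurable_int ig.
move=> s /=; rewrite in_itv/= => /andP[s0 st]; rewrite lee_fin normrM.
rewrite (ger0_norm (powR_ge0 (t - s) _)) [leRHS]ger0_norm; last first.
  by rewrite addr_ge0// mulr_ge0 ?powR_ge0// addr_ge0.
have [s2|s2] := leP s (t / 2).
  rewrite (@le_trans _ _ ((t / 2) `^ (- nu) * `|g s|))//; last first.
    by rewrite lerDl mulr_ge0 ?powR_ge0// addr_ge0.
  rewrite mulrC ler_wpM2r// !powRN lef_pV2 ?posrE ?powR_gt0 ?subr_gt0//; last lra.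
  by rewrite ge0_ler_powR ?nnegrE//; lra.
rewrite (@le_trans _ _ ((`|M| + 1) * (t - s) `^ (- nu)))//; last first.
  by rewrite lerDr mulr_ge0 ?powR_ge0.
by rewrite ler_wpM2r ?powR_ge0// gM// (ltW s2) ltW.
Qed.

(** * Energy inequalities *)

(* A named copy of the product measure, so that a sigma-finiteness instance can
   be attached to it: the one of the library is not inferred for [m1 \x m2]. *)
Section lebesgue_square.
Context (R : realType).

Definition lebesgue2 : set (measurableTypeR R * measurableTypeR R) -> \bar R :=
  (@lebesgue_measure R \x @lebesgue_measure R)%E.

HB.instance Definition _ := Measure.on lebesgue2.

Let lebesgue2_sigma_finite : sigma_finite setT lebesgue2.
Proof.
exists (fun n : nat => `[- n%:R : R, n%:R]%classic `*` `[- n%:R : R, n%:R]%classic).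
  apply/esym; rewrite -subTset => -[x y] _.
  exists (Num.truncn (Num.max `|x| `|y|)).+1 => //=.
  rewrite !in_itv/= -!ler_norml; split; apply/ltW/(le_lt_trans _ (truncnS_gt _)).
    by rewrite le_max lexx.
  by rewrite le_max lexx orbT.
move=> n; split; first exact: measurableX.
rewrite /lebesgue2 product_measure1E//.
have h : (@lebesgue_measure R `[(- n%:R)%R : R, n%:R%R]%classic < +oo)%E.
  by rewrite lebesgue_measure_itv/=; case: ifP => _; rewrite ?ltry// ?ltNye.
by apply: lte_mul_pinfty => //; rewrite ge0_fin_numE.
Qed.

HB.instance Definition _ :=
  Measure_isSigmaFinite.Build _ _ _ lebesgue2 lebesgue2_sigma_finite.

End lebesgue_square.

(** The triangle 0 < s < t < T is encoded in [h], so that the double integral lives on the whole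
    plane. The kernel [k] is left free in order to treat the power kernel and the exponentials
    alike. *)
Lemma convolution_fubini (R : realType) (psi g k : R -> R) (T : R) :
  let h := fun z : R * R => (psi \_ `]0, T[) z.1 * (g \_ `]0, T[) z.2 * (z.2 < z.1)%R%:R in
  (@lebesgue_measure R \x @lebesgue_measure R)%E.-integrable setT (fun z => (h z * k (z.1 - z.2))%:E) ->
  (forall t, 0 < t < T ->
    lebesgue_measure.-integrable `]0, t[ (EFin \o (fun s => g s * k (t - s)))) ->
  let w := fun t => psi t * \int[lebesgue_measure]_(s in `]0, t[) (g s * k (t - s)) in
  lebesgue_measure.-integrable `]0, T[ (EFin \o w) /\
  (\int[@lebesgue_measure R \x @lebesgue_measure R]_z (h z * k (z.1 - z.2))%:E =
   \int[lebesgue_measure]_(t in `]0%R, T[) (w t)%:E)%E.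
Proof.
move=> h ih ik w.
have inner t : (\int[lebesgue_measure]_s (h (t, s) * k (t - s))%:E)%E =
    ((EFin \o w) \_ `]0, T[) t.
  rewrite patchE; case: ifPn => [|tI]; last first.
    apply: integral0_eq => s _; rewrite /h/= patchE (negbTE tI) !mul0r//.
  rewrite inE/= in_itv/= => tT; have /andP[t0 tltT] := tT.
  rewrite /w EFinM fineK; last by apply: integrable_fin_num => //; exact: ik.
  rewrite -integralZl//; last exact: ik.
  rewrite [RHS]integral_mkcond/=; apply: eq_integral => s _.
  rewrite patchE /h/= !patchE !mem_setE/=.
  rewrite !in_itv/=; have [s0|s0] := ltP 0 s; last by rewrite /= !(mulr0,mul0r).
  have [st|st] := ltP s t; last by rewrite andbF /= mulr0 mul0r.
  by rewrite tT (lt_trans st tltT)/= mulr1 -EFinM mulrA.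
have intF := integrable_fubini_F ih.
have FE : fubini_F lebesgue_measure (fun z : R * R => (h z * k (z.1 - z.2))%:E) =
    ((EFin \o w) \_ `]0, T[) by apply/funext => t; exact: inner.
split.
  by apply/integrable_mkcond => //; rewrite -FE.
rewrite -(integral12_prod_meas1 ih) [RHS]integral_mkcond.
by apply: eq_integral => t _; exact: (congr1 (fun F => F t) FE).
Qed.

(** This is [kernel_mixture] on the plane with tau = t - s. The work lies in absolute integrability,
    since [g] may be unbounded near 0 and the kernel is unbounded along the diagonal. *)
Lemma fractional_energy (R : realType) (psi g : R -> R) (T nu : R) :
  0 < T -> 0 < nu -> nu < 1 ->
  {within `[0, T], continuous psi} ->
  lebesgue_measure.-integrable `]0, T[ (EFin \o g) ->
  (forall s, 0 < s -> {for s, continuous g}) ->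
  (forall lam, 0 <= lam ->
    0 <= \int[lebesgue_measure]_(t in `]0, T[)
      (psi t * \int[lebesgue_measure]_(s in `]0, t[) (g s * expR (- (lam * (t - s)))))) ->
  let w := fun t => psi t * \int[lebesgue_measure]_(s in `]0, t[) (g s * (t - s) `^ (- nu)) in
  lebesgue_measure.-integrable `]0, T[ (EFin \o w) /\
  0 <= \int[lebesgue_measure]_(t in `]0, T[) w t.
Proof.
move=> T0 nu0 nu1 cpsi ig cg hpos w.
have [M [_ hM]] : bounded_set (psi @` `[0, T]).
  by apply: compact_bounded; apply: continuous_compact => //; exact: segment_compact.
have psiM t : 0 < t < T -> `|psi t| <= `|M| + 1.
  move=> /andP[t0 tT]; apply: (hM (`|M| + 1)); first by rewrite (le_lt_trans (ler_norm _))// ltrDl.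
  by exists t => //=; rewrite in_itv/= !ltW.
pose psiI := psi \_ `]0, T[; pose gI := g \_ `]0, T[.
have psiIM t : `|psiI t| <= `|M| + 1.
  rewrite /psiI patchE; case: ifPn => [|_]; last by rewrite normr0 addr_ge0.
  by rewrite inE/= in_itv/=; exact: psiM.
have mpsiI : measurable_fun setT psiI.
  apply/(measurable_restrictT _ _).1 => //.
  apply: (@measurable_funS _ _ _ _ `[0, T]) => //.
    exact: subset_itv_oo_cc.
  by apply: subspace_continuous_measurable_fun.
have mgI : measurable_fun setT gI.
  apply/(measurable_restrictT _ _).1 => //.
  by apply/measurable_EFinP; exact: measurable_int ig.
pose tau (z : R * R) : R := z.1 - z.2.
pose h (z : R * R) : R := psiI z.1 * gI z.2 * (z.2 < z.1)%R%:R.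
have mtau : measurable_fun setT tau by exact: measurable_funB.
have mlt : measurable_fun setT (fun z : R * R => (z.2 < z.1)%R%:R : R).
  rewrite (_ : (fun _ => _) = (fun z : R * R => if z.2 < z.1 then 1 else 0 : R)); last first.
    by apply/funext => z; case: ifP.
  by apply: measurable_fun_ifT => //; exact: measurable_fun_ltr.
have mh : measurable_fun setT h.
  apply: measurable_funM => //; apply: measurable_funM => //; exact: measurableT_comp.
have h_tau z : h z != 0 -> 0 < tau z.
  rewrite /h /tau subr_gt0; case: ltP => // _; by rewrite mulr0 eqxx.
have h_tauT z : h z != 0 -> tau z < T.
  apply: contraNT; rewrite -leNgt /h /tau /psiI /gI !patchE !mem_setE/= !in_itv/=.
  move=> TZ; have [z10|_] := ltP 0 z.1; last by rewrite /= !mul0r.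
  have [z1T|_] := ltP z.1 T; last by rewrite /= !mul0r.
  have [z20|_] := ltP 0 z.2; last by rewrite /= mulr0 mul0r.
  lra.
pose mu := @lebesgue_measure R.
have mk : measurable_fun setT (fun z => h z * tau z `^ (- nu)).
  apply: measurable_funM => //.
  exact: (measurableT_comp (measurable_powR (- nu)) mtau).
have C0 : 0 <= T `^ (1 - nu) / (1 - nu).
  by rewrite divr_ge0 ?powR_ge0// subr_ge0 ltW.
(* Integrating in t first, at fixed s, separates the singularities: psi is bounded, and the kernel
   integrated from s to T gives at most T^(1 - nu) / (1 - nu), uniformly in s. What remains is the
   integral of |g|. *)
have inner s : (\int[mu]_t `|(h (t, s) * (t - s) `^ (- nu))%:E| <=
    ((`|M| + 1) * (T `^ (1 - nu) / (1 - nu)))%:E * `|gI s|%:E)%E.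
  have [sI|sI] := boolP (s \in `]0, T[%classic); last first.
    rewrite integral0_eq; first by rewrite mule_ge0// lee_fin mulr_ge0// addr_ge0.
    by move=> t _; rewrite /h/= /gI patchE (negbTE sI) mulr0 !mul0r normr0.
  have /andP[s0 sT] : 0 < s < T by move: sI; rewrite inE/= in_itv.
  have [ip pE] := integral_powR_left sT nu1.
  pose p (t : R) := (t - s) `^ (- nu).
  rewrite -/p in ip pE.
  apply: (@le_trans _ _ (\int[mu]_(t in `]s, T[) (((`|M| + 1) * `|gI s|)%:E * (EFin \o p) t))%E).
    rewrite [leRHS]integral_mkcond/=; apply: ge0_le_integral => //.
    - have mks : measurable_fun setT (fun t : R => h (t, s) * (t - s) `^ (- nu)) :=
        measurableT_comp mk (measurable_pair2 s).
      by apply: measurableT_comp => //; apply: measurableT_comp.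
    - apply/(measurable_restrictT _ _).1 => //; apply: emeasurable_funM => //.
      exact: measurable_int ip.
    - move=> t _; rewrite patchE /h/=.
      case: ifPn => [tI|]; last first.
        rewrite notin_setE/= in_itv/= => /negP.
        case: ltP => [st /= tT|_ _]; last by rewrite mulr0 mul0r normr0.
        by rewrite /psiI patchE mem_setE/= in_itv/= (negbTE tT) andbF !mul0r normr0.
      rewrite -EFinM lee_fin !normrM (ger0_norm (powR_ge0 _ _)).
      rewrite ler_wpM2r ?powR_ge0// -[leRHS]mulr1.
      rewrite ler_pM ?mulr_ge0//; first by rewrite ler_wpM2r.
      by case: ltP; rewrite /= ?normr1 ?normr0.
  rewrite integralZl//.
  have -> : (\int[mu]_(t in `]s, T[) (EFin \o p) t =
      ((T - s)%R `^ (1 - nu) / (1 - nu))%:E)%E.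
    by rewrite -pE /Rintegral fineK//; exact: integrable_fin_num.
  rewrite -!EFinM lee_fin -!mulrA ler_wpM2l ?addr_ge0// [leRHS]mulrA [leRHS]mulrC ler_wpM2l//.
  rewrite ler_wpM2r ?invr_ge0 ?subr_ge0 ?(ltW nu1)//.
  by rewrite ge0_ler_powR ?nnegrE ?subr_ge0 ?(ltW nu1) ?(ltW sT) ?(ltW T0)// gerBl ltW.
have igI : mu.-integrable setT (EFin \o gI).
  rewrite /gI -restrict_EFin; by apply/integrable_restrict => //=; rewrite setTI.
have ih : (mu \x mu)%E.-integrable setT (fun z => (h z * tau z `^ (- nu))%:E).
  have mE : measurable_fun setT (fun z => (h z * tau z `^ (- nu))%:E).
    by apply/measurable_EFinP; exact: mk.
  apply/integrable21ltyP => //.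
  apply: (@le_lt_trans _ _ (\int[mu]_s (((`|M| + 1) * (T `^ (1 - nu) / (1 - nu)))%:E * `|(EFin \o gI) s|))%E).
    apply: ge0_le_integral => //.
    - by move=> s _; exact: integral_ge0.
    - have := @measurable_fun_fubini_tonelli_G _ _ _ _ R mu _
        (measurableT_comp (@abse_measurable R setT) mE).
      by apply => z; exact: abse_ge0.
    - apply: emeasurable_funM => //; apply: measurableT_comp => //.
      exact: measurable_int igI.
  rewrite ge0_integralZl//; last first.
  - by rewrite lee_fin mulr_ge0// addr_ge0.
  - apply: measurableT_comp => //; exact: measurable_int igI.
  rewrite lte_mul_pinfty//; first by rewrite lee_fin mulr_ge0// addr_ge0.
  by case/integrableP : igI.
(* On the support of [h], 0 < tau < T, so exp(- lam tau) <= 1 <= T^nu tau^(-nu): the power kernel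
   dominates the exponential ones. *)
have ihexp lam : 0 <= lam -> (mu \x mu)%E.-integrable setT (fun z => (h z * expR (- (lam * tau z)))%:E).
  move=> lam0; have iT := integrableZl measurableT (T `^ nu) ih.
  apply: le_integrable iT => //.
    apply/measurable_EFinP; apply: measurable_funM => //.
    by apply: measurableT_comp => //; apply: measurableT_comp => //; exact: measurable_funM.
  move=> z _; rewrite lee_fin; have [->|hz] := eqVneq (h z) 0.
    by rewrite !mul0r mulr0.
  rewrite mulrCA !normrM ler_wpM2l// ger0_norm ?expR_ge0// -normrM ger0_norm; last first.
    by rewrite mulr_ge0 ?powR_ge0.
  have t0 := h_tau _ hz; have tT := h_tauT _ hz.
  apply: (@le_trans _ _ 1).
    by rewrite -expR0 ler_expR oppr_le0 mulr_ge0// ltW.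
  rewrite powRN ler_pdivlMr ?powR_gt0// mul1r.
  by rewrite ge0_ler_powR ?nnegrE ?ltW.
have icv t : 0 < t < T -> mu.-integrable `]0, t[ (EFin \o g).
  move=> /andP[t0 tT]; apply: integrableS ig => //.
  by apply: subset_itvl; rewrite bnd_simp ltW.
have [] := @convolution_fubini R psi g (fun x => x `^ (- nu)) T ih.
  move=> t tT; have /andP[t0 _] := tT.
  apply: integrable_convolution; rewrite ?(ltW nu0)//; first exact: icv.
  by move=> s /andP[s0 _]; exact: cg.
move=> iw wE; split; first exact: iw.
apply: fine_ge0; rewrite -[leRHS]wE.
pose X := (measurableTypeR R * measurableTypeR R)%type.
have mhX : measurable_fun [set: X] h := mh.
have mtauX : measurable_fun [set: X] tau := mtau.
have ih2 : (@lebesgue2 R).-integrable [set: X] (fun z => (h z * tau z `^ (- nu))%:E) := ih.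
have := kernel_mixture nu0 (ltW nu1) mhX mtauX h_tau ih2.
apply=> lam lam0.
have [] := @convolution_fubini R psi g (fun x => expR (- (lam * x))) T (ihexp _ lam0).
  move=> t tT; have ct := icv _ tT; have /andP[t0 _] := tT.
  apply: le_integrable ct => //.
    apply/measurable_EFinP; apply: measurable_funM.
      by apply/measurable_EFinP; exact: measurable_int (icv _ tT).
    by apply: measurableT_comp => //; apply: measurableT_comp => //;
      apply: measurable_funM => //; exact: measurable_funB.
  move=> s /=; rewrite in_itv/= => /andP[s0 st].
  rewrite lee_fin normrM ler_piMr// ger0_norm ?expR_ge0// -expR0 ler_expR.
  by rewrite oppr_le0 mulr_ge0// subr_ge0 ltW.
move=> iwl wlE; rewrite [leRHS]wlE.
have := hpos _ lam0; rewrite -lee_fin /Rintegral fineK//.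
exact: integrable_fin_num.
Qed.

Lemma within_itvcy_cc (R : realType) (f : R -> R) (T : R) :
  {within `[0, +oo[, continuous f} -> {within `[0, T], continuous f}.
Proof.
by apply: continuous_subspaceW => x /=; rewrite !in_itv/= andbT => /andP[].
Qed.

Lemma within_itvcy_for (R : realType) (f : R -> R) (x : R) :
  {within `[0, +oo[, continuous f} -> 0 < x -> {for x, continuous f}.
Proof.
by move=> /continuous_within_itvcyP[+ _] x0; apply; rewrite in_itv/= x0.
Qed.

Lemma within_integrable_oo (R : realType) (f : R -> R) (T : R) :
  {within `[0, T], continuous f} -> lebesgue_measure.-integrable `]0, T[ (EFin \o f).
Proof.
move=> cf; have : lebesgue_measure.-integrable `[0, T] (EFin \o f).
  by apply: continuous_compact_integrable => //; exact: segment_compact.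
by apply: integrableS => //; exact: subset_itv_oo_cc.
Qed.

Lemma withinM (R : realType) (A : set R) (f g : R -> R) :
  {within A, continuous f} -> {within A, continuous g} ->
  {within A, continuous (fun x => f x * g x)}.
Proof.
move=> /subspace_continuousP cf /subspace_continuousP cg.
by apply/subspace_continuousP => x Ax; apply: cvgM; [exact: cf|exact: cg].
Qed.

Lemma withinB (R : realType) (A : set R) (f g : R -> R) :
  {within A, continuous f} -> {within A, continuous g} ->
  {within A, continuous (fun x => f x - g x)}.
Proof.
move=> /subspace_continuousP cf /subspace_continuousP cg.
by apply/subspace_continuousP => x Ax; apply: cvgB; [exact: cf|exact: cg].
Qed.

Lemma continuous_expRM (R : realType) (lam : R) : continuous (fun x : R => expR (lam * x)).
Proof.
move=> x; apply: continuous_cvg; first exact: continuous_expR.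
by apply: cvgM; [exact: cvg_cst|exact: cvg_id].
Qed.

(** * Positivity for exponential kernels *)

Section exponential_kernel.
Variables (R : realType) (lam t : R).

Let e (s : R) := expR (- (lam * (t - s))).

Lemma continuous_expk : continuous e.
Proof.
move=> s; apply: continuous_cvg; first exact: continuous_expR.
apply: cvgN; apply: cvgM; first exact: cvg_cst.
by apply: cvgB; [exact: cvg_cst|exact: cvg_id].
Qed.

Lemma is_derive_expk (s : R) : is_derive s 1 e (lam * e s).
Proof.
have dL : is_derive s 1 (fun s => - (lam * (t - s))) lam.
  apply: is_derive_eq; rewrite /GRing.scale/=; ring.
apply: (is_derive_eq (@is_derive1_comp _ expR _ s _ _ (is_derive_expR _) dL)).
by rewrite mulrC.
Qed.

Lemma integrable_expk (g : R -> R) : 0 <= lam ->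
  lebesgue_measure.-integrable `]0, t[ (EFin \o g) ->
  lebesgue_measure.-integrable `]0, t[ (EFin \o (fun s => g s * e s)).
Proof.
move=> lam0 ig; apply: le_integrable (ig) => //.
  apply/measurable_EFinP; apply: measurable_funM.
    by apply/measurable_EFinP; exact: measurable_int ig.
  apply: measurable_funTS; apply: continuous_measurable_fun; exact: continuous_expk.
move=> s /=; rewrite in_itv/= => /andP[s0 st].
rewrite lee_fin normrM ler_piMr// ger0_norm ?expR_ge0// -expR0 ler_expR.
by rewrite oppr_le0 mulr_ge0// subr_ge0 ltW.
Qed.

End exponential_kernel.

Section exponential_convolution.
Variables (R : realType) (psi : R -> R) (lam : R).
Hypothesis cpsi : {within `[0, +oo[, continuous psi}.
Local Notation mu := lebesgue_measure.

(** The convolution of psi with exp(- lam t), that is the solution of u' = psi - lam u with u(0) =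
    0. Factoring exp(- lam t) out leaves t only in the bound of the integral, so that u can be
    differentiated by the fundamental theorem. *)
Definition expconv (t : R) : R :=
  expR (- lam * t) * \int[mu]_(s in `[0, t]) (psi s * expR (lam * s)).

Let cpsie : {within `[0, +oo[, continuous (fun s => psi s * expR (lam * s))}.
Proof. by apply: withinM => //; apply: continuous_subspaceT; exact: continuous_expRM. Qed.

Let ie (T : R) : mu.-integrable `[0, T] (EFin \o (fun s => psi s * expR (lam * s))).
Proof.
apply: continuous_compact_integrable; first exact: segment_compact.
exact: within_itvcy_cc.
Qed.

Lemma expconv0 : expconv 0 = 0.
Proof. by rewrite /expconv set_itv1 Rintegral_set1 mulr0. Qed.

Lemma within_expconv (T : R) : 0 < T -> {within `[0, T], continuous expconv}.
Proof.
move=> T0; apply: withinM.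
  by apply: continuous_subspaceT; exact: continuous_expRM.
by apply: parameterized_integral_continuous => //; exact: ltW.
Qed.

Lemma is_derive_expconv (t : R) : 0 < t -> is_derive t 1 expconv (psi t - lam * expconv t).
Proof.
move=> t0; pose P (t : R) := \int[mu]_(s in `[0, t]) (psi s * expR (lam * s)).
have [dP P'] : derivable P t 1 /\ P^`()%classic t = psi t * expR (lam * t).
  apply: (@continuous_FTC1_closed R (fun s => psi s * expR (lam * s)) 0 t (t + 1)) => //.
    by rewrite ltrDl.
  exact: (@within_itvcy_for _ _ _ cpsie).
have d1 : is_derive t 1 P (psi t * expR (lam * t)).
  by apply: (DeriveDef dP); rewrite -derive1E.
have dL : is_derive t 1 (fun t => - lam * t) (- lam).
  by apply: is_derive_eq; exact: mulr1.
have d2 : is_derive t 1 (fun t => expR (- lam * t)) (expR (- lam * t) * - lam).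
  exact: (@is_derive1_comp _ expR (fun t => - lam * t)).
apply: (is_derive_eq (is_deriveM d2 d1)).
have ee : expR (- lam * t) * expR (lam * t) = 1 by rewrite -expRD mulNr addNr expR0.
rewrite /expconv -/(P t) /GRing.scale/=.
transitivity (psi t * (expR (- lam * t) * expR (lam * t)) - lam * (expR (- lam * t) * P t)).
  by ring.
by rewrite ee mulr1.
Qed.

Lemma expconvE (t : R) : 0 < t ->
  \int[mu]_(s in `]0, t[) (psi s * expR (- (lam * (t - s)))) = expconv t.
Proof.
move=> t0.
have ck : {within `[0, +oo[, continuous (fun s => psi s * expR (- (lam * (t - s))))}.
  by apply: withinM => //; apply: continuous_subspaceT; exact: continuous_expk.
have ik : mu.-integrable `[0, t] (EFin \o (fun s => psi s * expR (- (lam * (t - s))))).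
  by apply: continuous_compact_integrable; [exact: segment_compact|exact: within_itvcy_cc].
rewrite Rintegral_itv_bndo_bndc; last first.
  by apply: integrableS ik => //; exact: subset_itv_oo_cc.
rewrite Rintegral_itv_obnd_cbnd; last first.
  by apply: integrableS ik => //; exact: subset_itv_oc_cc.
rewrite /expconv -RintegralZl//.
apply: eq_Rintegral => s _; rewrite mulrCA -expRD; congr (_ * expR _); ring.
Qed.

(* With u = [expconv], u' = psi - lam u gives psi u = (u^2 / 2)' + lam u^2. *)
Lemma exp_energy (T : R) : 0 < T -> 0 <= lam ->
  0 <= \int[mu]_(t in `]0, T[)
    (psi t * \int[mu]_(s in `]0, t[) (psi s * expR (- (lam * (t - s))))).
Proof.
move=> T0 lam0.
have cU := within_expconv T0; have cp := within_itvcy_cc (T := T) cpsi.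
have cl : {within `[0, T], continuous (fun=> lam)} by apply: continuous_subspaceT; exact: cst_continuous.
rewrite (@eq_Rintegral _ _ R mu _ (fun t => psi t * expconv t)); last first.
  by move=> t; rewrite inE/= in_itv/= => /andP[t0 _]; rewrite expconvE.
pose V t := psi t - lam * expconv t.
have cV : {within `[0, T], continuous V} by apply: withinB => //; exact: withinM.
have cf : {within `[0, T], continuous (fun t => expconv t * V t)} by exact: withinM.
apply: (@le_trans _ _ (\int[mu]_(t in `]0, T[) (expconv t * V t))).
  have -> : \int[mu]_(t in `]0, T[) (expconv t * V t) = expconv T ^+ 2 / 2 - expconv 0 ^+ 2 / 2.
    apply: (@FTC2_integrable _ (fun t => expconv t ^+ 2 / 2) _ _ _ T0 _ _ _ (within_integrable_oo cf)).
    - apply: withinM; last by apply: continuous_subspaceT; exact: cst_continuous.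
      exact: withinM.
    - move=> t /andP[t0 _]; have dU := is_derive_expconv t0.
      rewrite (_ : (fun t => _) = 2^-1 \*: (expconv ^+ 2)); last first.
        by apply/funext => x /=; rewrite mulrC.
      apply: is_derive_eq; rewrite /GRing.scale/= expr1 /V; lra.
    - move=> t tT; apply: (within_continuous_continuous T0 cf).
      by rewrite in_itv.
  by rewrite expconv0 expr0n/= mul0r subr0 divr_ge0// sqr_ge0.
apply: le_Rintegral => //; [exact: within_integrable_oo| |].
  by apply: within_integrable_oo; exact: withinM.
move=> t _; rewrite /V mulrBr [leRHS]mulrC gerBl mulrCA -expr2.
by rewrite mulr_ge0// sqr_ge0.
Qed.

(* The inner integral is u', and psi u' = u'^2 + lam (u^2 / 2)'. *)
Lemma exp_energy_derive (g : R -> R) (T : R) : 0 < T -> 0 <= lam -> psi 0 = 0 ->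
  (forall t : R, 0 < t -> is_derive t 1 psi (g t)) ->
  (forall t : R, 0 < t -> {for t, continuous g}) ->
  mu.-integrable `]0, T[ (EFin \o g) ->
  0 <= \int[mu]_(t in `]0, T[)
    (psi t * \int[mu]_(s in `]0, t[) (g s * expR (- (lam * (t - s))))).
Proof.
move=> T0 lam0 psi0 dpsi cg ig.
have cU := within_expconv T0; have cp := within_itvcy_cc (T := T) cpsi.
have cl : {within `[0, T], continuous (fun=> lam)} by apply: continuous_subspaceT; exact: cst_continuous.
pose V t := psi t - lam * expconv t.
have cV : {within `[0, T], continuous V} by apply: withinB => //; exact: withinM.
have inner t : 0 < t < T -> \int[mu]_(s in `]0, t[) (g s * expR (- (lam * (t - s)))) = V t.
  move=> /andP[t0 tT].
  pose e (s : R) := expR (- (lam * (t - s))).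
  have ce : continuous e := @continuous_expk R lam t.
  have de : forall s : R, is_derive s 1 e (lam * e s) := @is_derive_expk R lam t.
  have ige : mu.-integrable `]0, t[ (EFin \o (fun s => g s * e s)).
    apply: integrable_expk => //.
    by apply: integrableS ig => //; apply: subset_itvl; rewrite bnd_simp ltW.
  have cpe : {within `[0, t], continuous (fun s => psi s * e s)}.
    by apply: withinM; [exact: within_itvcy_cc|exact: continuous_subspaceT].
  have ipe := within_integrable_oo cpe.
  (* Integration by parts: e' = lam e, e(t) = 1, and the boundary term at 0 vanishes by [psi0]. The
     inner integral is therefore psi - lam u = u'. *)
  have : \int[mu]_(s in `]0, t[) (g s * e s + lam * (psi s * e s)) = psi t * e t - psi 0 * e 0.
    apply: (@FTC2_integrable _ (fun s => psi s * e s)) => //.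
    - move=> s /andP[s0 _]; have ds := dpsi _ s0; have des := de s.
      apply: is_derive_eq; rewrite /GRing.scale/=; ring.
    - move=> s /andP[s0 _]; have cps := within_itvcy_for cpsi s0.
      apply: cvgD; apply: cvgM.
      + exact: cg.
      + exact: ce.
      + exact: cvg_cst.
      + by apply: cvgM; [exact: cps|exact: ce].
    - rewrite (_ : EFin \o _ = (EFin \o (fun s => g s * e s)) \+
        (fun s => lam%:E * (EFin \o (fun s => psi s * e s)%R) s)%E)//.
      by apply: integrableD => //; exact: integrableZl.
  rewrite RintegralD//; last by apply: integrableZl ipe.
  have et : e t = 1 by rewrite /e subrr mulr0 oppr0 expR0.
  rewrite RintegralZl// psi0 mul0r subr0 et mulr1 => H.
  by rewrite /V -(expconvE t0) -H addrK.
rewrite (@eq_Rintegral _ _ R mu _ (fun t => psi t * V t)); last first.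
  by move=> t; rewrite inE/= in_itv/= => tT; rewrite inner.
have cf : {within `[0, T], continuous (fun t => lam * (expconv t * V t))}.
  by apply: withinM => //; exact: withinM.
apply: (@le_trans _ _ (\int[mu]_(t in `]0, T[) (lam * (expconv t * V t)))).
  have -> : \int[mu]_(t in `]0, T[) (lam * (expconv t * V t)) =
      lam * (expconv T ^+ 2 / 2) - lam * (expconv 0 ^+ 2 / 2).
    apply: (@FTC2_integrable _ (fun t => lam * (expconv t ^+ 2 / 2))
      _ _ _ T0 _ _ _ (within_integrable_oo cf)).
    - apply: withinM => //; apply: withinM; last by apply: continuous_subspaceT; exact: cst_continuous.
      exact: withinM.
    - move=> t /andP[t0 _]; have dU := is_derive_expconv t0.
      rewrite (_ : (fun t => _) = (lam / 2) \*: (expconv ^+ 2)); last first.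
        by apply/funext => x /=; rewrite /GRing.scale/= mulrA mulrAC.
      apply: is_derive_eq; rewrite /GRing.scale/= expr1 /V; lra.
    - move=> t tT; apply: (within_continuous_continuous T0 cf).
      by rewrite in_itv.
  by rewrite expconv0 expr0n/= mul0r mulr0 subr0 mulr_ge0// divr_ge0// sqr_ge0.
apply: le_Rintegral => //; [exact: within_integrable_oo| |].
  by apply: within_integrable_oo; exact: withinM.
move=> t _; rewrite mulrA -subr_ge0 -mulrBl -/(V t) -expr2; exact: sqr_ge0.
Qed.

End exponential_convolution.

(** * The telegraph equation *)

(** The Riemann-Liouville integral of order 1 - nu, read as the identity at nu = 1. Applied to phi'
    with order nu, or to phi'' with order nu - 1, it gives the Caputo derivative of order nu, so
    that all orders are brought into (0, 1]. *)
Definition fracop (R : realType) (nu : R) (g : R -> R) (t : R) : R :=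
  if nu == 1 then g t
  else (Gamma (1 - nu))^-1 * \int[lebesgue_measure]_(s in `]0, t[) (g s * (t - s) `^ (- nu)).

Lemma ceiln_eq1 (R : realType) (nu : R) : 0 < nu -> nu <= 1 -> ceiln nu = 1%N.
Proof.
move=> nu0 nu1; rewrite /ceiln.
have -> // : Num.ceil nu = 1.
by apply/eqP; rewrite ceil_eq subrr nu0.
Qed.

Lemma ceiln_eq2 (R : realType) (nu : R) : 1 < nu -> nu <= 2 -> ceiln nu = 2%N.
Proof.
move=> nu0 nu1; rewrite /ceiln.
have -> // : Num.ceil nu = 2.
by apply/eqP; rewrite ceil_eq (_ : 2 - 1 = 1)// nu0.
Qed.

Lemma caputo1E (R : realType) (nu : R) (phi : R -> R) : 0 < nu -> nu <= 1 ->
  caputo nu phi = fracop nu phi^`()%classic.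
Proof.
move=> nu0 nu1; apply/funext => t.
rewrite /caputo (ceiln_eq1 nu0 nu1) /fracop; case: ifP => _; first by [].
by rewrite addrAC subrr sub0r.
Qed.

Lemma caputo2E (R : realType) (nu : R) (phi : R -> R) : 1 < nu -> nu <= 2 ->
  caputo nu phi = fracop (nu - 1) (derive1n 2 phi).
Proof.
move=> nu0 nu1; apply/funext => t.
rewrite /caputo (ceiln_eq2 nu0 nu1) /fracop subr_eq; case: ifP => _; first by [].
have -> : 1 - (nu - 1) = 2 - nu by ring.
by have -> : 2 - nu - 1 = - (nu - 1) by ring.
Qed.

(** In the inequalities the normalizing factor enters only through its sign. *)
Lemma Gamma_ge0 (R : realType) (a : R) : 0 <= Gamma a.
Proof. by apply: Rintegral_ge0 => x _; rewrite mulr_ge0 ?powR_ge0 ?expR_ge0. Qed.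

(* For the kernel e = exp (- lam (t - s)), the derivative of (phi - phi t) e is at
   most g e, and this function is nonpositive at 0 and vanishes at t. *)
Lemma frac_integral_max_ge0 (R : realType) (phi g : R -> R) (t nu : R) :
  0 < t -> 0 < nu -> nu < 1 ->
  {within `[0, t], continuous phi} ->
  (forall s : R, 0 < s -> is_derive s 1 phi (g s)) ->
  (forall s : R, 0 < s -> {for s, continuous g}) ->
  lebesgue_measure.-integrable `]0, t[ (EFin \o g) ->
  (forall s : R, 0 <= s <= t -> phi s <= phi t) ->
  0 <= \int[lebesgue_measure]_(s in `]0, t[) (g s * (t - s) `^ (- nu)).
Proof.
move=> t0 nu0 nu1 cphi dphi cg ig phimax.
pose mu := @lebesgue_measure R.
pose h := g \_ `]0, t[.
pose tau (s : R) := t - s.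
have hE (k : R -> R) : (\int[mu]_(s in `]0%R, t[) (g s * k s)%:E = \int[mu]_s (h s * k s)%:E)%E.
  rewrite integral_mkcond; apply: eq_integral => s _.
  by rewrite /h !patchE; case: ifP => //; rewrite mul0r.
have hI (k : R -> R) : mu.-integrable `]0, t[ (EFin \o (fun s => g s * k s)) ->
    mu.-integrable setT (fun s => (h s * k s)%:E).
  move=> igk; rewrite (_ : (fun _ => _) = (EFin \o (fun s => g s * k s)) \_ `]0, t[).
    by apply/integrable_restrict => //=; rewrite setTI.
  by apply/funext => s; rewrite /h !patchE; case: ifP => //; rewrite mul0r.
apply: fine_ge0; rewrite [leRHS]hE.
have mh : measurable_fun (setT : set (measurableTypeR R)) h.
  apply/(measurable_restrictT _ _).1 => //.
  by apply/measurable_EFinP; exact: measurable_int ig.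
have mtau : measurable_fun (setT : set (measurableTypeR R)) tau by exact: measurable_funB.
have h_tau s : h s != 0 -> 0 < tau s.
  rewrite /h patchE; case: ifPn; last by rewrite eqxx.
  by rewrite inE/= in_itv/= /tau subr_gt0 => /andP[].
have ih : mu.-integrable setT (fun s => (h s * tau s `^ (- nu))%:E).
  apply: (hI (fun s => tau s `^ (- nu))).
  by apply: integrable_convolution => //; [exact: ltW|move=> s /andP[s0 _]; exact: cg].
have := kernel_mixture nu0 (ltW nu1) mh mtau h_tau ih; apply=> lam lam0.
pose e (s : R) := expR (- (lam * (t - s))).
rewrite -(hE e).
have ce : continuous e := @continuous_expk R lam t.
have de : forall s : R, is_derive s 1 e (lam * e s) := @is_derive_expk R lam t.
have ige : mu.-integrable `]0, t[ (EFin \o (fun s => g s * e s)) by exact: integrable_expk.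
pose G s := phi s - phi t.
have cG : {within `[0, t], continuous G}.
  by apply: withinB => //; apply: continuous_subspaceT; exact: cst_continuous.
have cGe : {within `[0, t], continuous (fun s => G s * e s)}.
  by apply: withinM => //; exact: continuous_subspaceT.
have iGe := within_integrable_oo cGe.
have iS : mu.-integrable `]0, t[ (EFin \o (fun s => g s * e s + lam * (G s * e s))).
  rewrite (_ : EFin \o _ = (EFin \o (fun s => g s * e s)) \+
    (fun s => lam%:E * (EFin \o (fun s => G s * e s)%R) s)%E)//.
  by apply: integrableD => //; exact: integrableZl.
have FTC : \int[mu]_(s in `]0, t[) (g s * e s + lam * (G s * e s)) = G t * e t - G 0 * e 0.
  apply: (FTC2_integrable t0 cGe _ _ iS).
  - move=> s /andP[s0 _]; have ds := dphi _ s0; have des := de s.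
    have dG : is_derive s 1 G (g s) by apply: is_derive_eq; exact: subr0.
    apply: is_derive_eq; rewrite /GRing.scale/=; ring.
  - move=> s /andP[s0 st].
    apply: cvgD; apply: cvgM.
    + exact: cg.
    + exact: ce.
    + exact: cvg_cst.
    + apply: (within_continuous_continuous t0 cGe).
      by rewrite in_itv/= s0.
have : 0 <= \int[mu]_(s in `]0, t[) (g s * e s).
  apply: (@le_trans _ _ (\int[mu]_(s in `]0, t[) (g s * e s + lam * (G s * e s)))).
    rewrite FTC /G subrr mul0r sub0r oppr_ge0 pmulr_lle0 ?expR_gt0//.
    by rewrite subr_le0 phimax// lexx ltW.
  apply: le_Rintegral => // s; rewrite /= in_itv/= => /andP[s0 st].
  rewrite gerDl mulr_ge0_le0// mulr_le0_ge0 ?expR_ge0// subr_le0 phimax//.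
  by rewrite !ltW.
by rewrite -lee_fin /Rintegral fineK//; exact: integrable_fin_num.
Qed.

(** Since t is the right end of [[0, t]], a maximum there gives phi'(t) >= 0, which settles nu = 1;
    for nu < 1 the exponential mixture applies. *)
Lemma fracop_max_ge0 (R : realType) (phi g : R -> R) (t nu : R) :
  0 < t -> 0 < nu -> nu <= 1 ->
  {within `[0, t], continuous phi} ->
  (forall s : R, 0 < s -> is_derive s 1 phi (g s)) ->
  (forall s : R, 0 < s -> {for s, continuous g}) ->
  lebesgue_measure.-integrable `]0, t[ (EFin \o g) ->
  (forall s : R, 0 <= s <= t -> phi s <= phi t) ->
  0 <= fracop nu g t.
Proof.
move=> t0 nu0 nu1 cphi dphi cg ig phimax; rewrite /fracop; case: ifPn => [_|nuN1].
  rewrite leNgt; apply/negP => gt0.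
  have /nbhs_ballP[d /= d0 gd] : \forall s \near t, g s < 0.
    by have /cvgr_lt := cg _ t0; exact.
  (* This point lies in ]0, t[ and within d of t, so [g] < 0 on ]s, t[ and the mean value theorem
     would give phi t < phi s. *)
  pose s := Num.max (t / 2) (t - d / 2).
  have st : s < t by rewrite gt_max; apply/andP; split; lra.
  have s0 : 0 < s by rewrite lt_max; apply/orP; left; lra.
  have sd : t - d < s by rewrite lt_max; apply/orP; right; lra.
  have [c] : exists2 c, c \in `]s, t[ & phi t - phi s = g c * (t - s).
    apply: (@MVT R phi g s t st).
      by move=> x; rewrite in_itv/= => /andP[sx _]; apply: dphi; exact: lt_trans sx.
    apply: continuous_subspaceW cphi => x /=; rewrite !in_itv/= => /andP[sx ->].
    by rewrite (le_trans _ sx)// ltW.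
  rewrite in_itv/= => /andP[sc ct] E.
  have : 0 <= phi t - phi s by rewrite subr_ge0 phimax// !ltW.
  rewrite E leNgt nmulr_rlt0 ?subr_gt0 ?st//.
  by apply: gd; rewrite /ball/= gtr0_norm; lra.
rewrite mulr_ge0 ?invr_ge0 ?Gamma_ge0//.
by apply: (@frac_integral_max_ge0 _ phi) => //; rewrite lt_neqAle nuN1.
Qed.

Lemma fracopN (R : realType) (g : R -> R) (t nu : R) :
  0 < t -> 0 < nu -> nu <= 1 ->
  (forall s : R, 0 < s -> {for s, continuous g}) ->
  lebesgue_measure.-integrable `]0, t[ (EFin \o g) ->
  fracop nu (fun s => - g s) t = - fracop nu g t.
Proof.
move=> t0 nu0 nu1 cg ig; rewrite /fracop; case: ifPn => // nuN1.
have ik : lebesgue_measure.-integrable `]0, t[ (EFin \o (fun s => g s * (t - s) `^ (- nu))).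
  apply: integrable_convolution => //; first exact: ltW.
    by rewrite lt_neqAle nuN1.
  by move=> s /andP[s0 _]; exact: cg.
rewrite -mulrN; congr (_ * _); rewrite -[RHS]mulN1r -RintegralZl//.
by apply: eq_Rintegral => s _; rewrite mulN1r mulNr.
Qed.

(** The initial condition is an inequality so that the result also applies to - phi, which starts at
    -1; together the two give the bound on |phi|. *)
Lemma max_principle (R : realType) (phi g : R -> R) (k xi nu1 nu2 : R) :
  0 < nu1 -> nu1 <= 1 -> 0 < nu2 -> nu2 <= 1 -> 0 < k -> xi != 0 ->
  {within `[0, +oo[, continuous phi} ->
  (forall s : R, 0 < s -> is_derive s 1 phi (g s)) ->
  (forall s : R, 0 < s -> {for s, continuous g}) ->
  (forall T : R, 0 < T -> lebesgue_measure.-integrable `]0, T[ (EFin \o g)) ->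
  (forall t : R, 0 < t -> k * fracop nu1 g t + fracop nu2 g t = - xi ^+ 2 * phi t) ->
  phi 0 <= 1 ->
  forall T : R, 0 <= T -> phi T <= 1.
Proof.
move=> nu10 nu11 nu20 nu21 k0 xi0 cphi dphi cg ig eqn phi0 T T0.
rewrite leNgt; apply/negP => phiT.
have [t] := EVT_max T0 (within_itvcy_cc (T := T) cphi).
rewrite in_itv/= => /andP[t0 tT] tmax.
have phit : 1 < phi t by rewrite (lt_le_trans phiT)// tmax// in_itv/= T0 lexx.
have {}t0 : 0 < t.
  rewrite lt_neqAle t0 andbT; apply/eqP => t0'.
  by move: phit; rewrite -t0' ltNge phi0.
have D nu : 0 < nu -> nu <= 1 -> 0 <= fracop nu g t.
  move=> ? ?; apply: (@fracop_max_ge0 _ phi) => //.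
  - exact: within_itvcy_cc.
  - exact: ig.
  - by move=> s /andP[s0 st]; apply: tmax; rewrite in_itv/= s0 (le_trans st).
have : 0 <= k * fracop nu1 g t + fracop nu2 g t.
  by rewrite addr_ge0 ?D// mulr_ge0 ?D// ltW.
rewrite eqn// mulNr oppr_ge0 leNgt => /negP; apply.
by rewrite mulr_gt0 ?(lt_trans _ phit)// exprn_even_gt0.
Qed.

Lemma telegraph_bound_low (R : realType) (alpha k xi : R) (phi : R -> R) :
  0 < alpha -> alpha <= 2^-1 -> 0 < k -> xi != 0 ->
  telegraph_sol alpha k xi phi ->
  forall T : R, 0 <= T -> `|phi T| <= 1.
Proof.
move=> a0 a1 k0 xi0.
have [b1 c0 c1] : [/\ alpha <= 1, 0 < 2 * alpha & 2 * alpha <= 1] by split; lra.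
move=> [cphi]; rewrite (ceiln_eq1 c0 c1) => dphi cg ig eqn phi0 _ T T0.
set g := phi^`()%classic.
have dg (s : R) : 0 < s -> is_derive s 1 phi (g s).
  by move=> s0; apply: DeriveDef; [exact: (dphi 0%N)|rewrite -derive1E].
have eqn' (t : R) : 0 < t -> k * fracop alpha g t + fracop (2 * alpha) g t = - xi ^+ 2 * phi t.
  by move=> t0; rewrite -(eqn t t0) (caputo1E _ a0 b1) (caputo1E _ c0 c1).
rewrite ler_norml; apply/andP; split; last first.
  by apply: (max_principle a0 b1 c0 c1 k0 xi0 cphi dg cg ig eqn' _ T0); rewrite phi0.
rewrite lerNl; apply: (@max_principle _ (fun s => - phi s) (fun s => - g s) k xi
  alpha (2 * alpha) a0 b1 c0 c1 k0 xi0 _ _ _ _ _ _ T T0).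
- by apply/subspace_continuousP => x x0; apply: cvgN; move/subspace_continuousP : cphi; exact.
- by move=> s s0; have := dg s s0 => d; apply: is_derive_eq.
- by move=> s s0; apply: cvgN; exact: cg.
- move=> t t0; have ig' := integrableN (ig t t0).
  exact: ig'.
- move=> t t0; rewrite (fracopN t0 a0 b1 cg (ig t t0)) (fracopN t0 c0 c1 cg (ig t t0)).
  by rewrite mulrN -opprD (eqn' t t0) mulrN.
- by rewrite phi0; lra.
Qed.

(** On ]0, 1[, h(t) is h(1) minus the integral of g over ]t, 1[, and the latter converges as t tends
    to 0 because g is integrable. With h = phi', this gives phi' a limit at 0 before its value is
    known. *)
Lemma derive_at_right_limit (R : realType) (h g : R -> R) :
  (forall t : R, 0 < t -> is_derive t 1 h (g t)) ->
  (forall t : R, 0 < t -> {for t, continuous g}) ->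
  lebesgue_measure.-integrable `]0, 1[ (EFin \o g) ->
  exists L : R, h t @[t --> (0 : R)^'+] --> L.
Proof.
move=> dh cg ig; pose mu := @lebesgue_measure R.
have igc := integrable_itv_oo_cc ig.
have ch t : 0 < t -> {for t, continuous h}.
  by move=> /dh/@ex_derive/derivable1_diffP/differentiable_continuous.
(* The final 0 is the limit of the integral of [g] over [[0, t]]. *)
exists (h 1 - \int[mu]_(s in `[0, 1]) g s + 0).
have hE t : 0 < t < 1 -> h t = h 1 - \int[mu]_(s in `[0, 1]) g s + \int[mu]_(s in `[0, t]) g s.
  move=> /andP[t0 t1].
  have it1 : mu.-integrable `]t, 1[ (EFin \o g).
    by apply: integrableS ig => //; apply: subset_itvr; rewrite bnd_simp ltW.
  have FTC : \int[mu]_(s in `]t, 1[) g s = h 1 - h t.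
    apply: (@FTC2_integrable _ h) => //.
    - apply: continuous_in_subspaceT => s; rewrite inE/= in_itv/= => /andP[ts _].
      by apply: ch; exact: lt_le_trans ts.
    - by move=> s /andP[ts _]; apply: dh; exact: lt_trans ts.
    - by move=> s /andP[ts _]; apply: cg; exact: lt_trans ts.
  have := @Rintegral_itvB R g (BLeft 0) (BRight 1) t igc.
  rewrite !bnd_simp (ltW t0) (ltW t1) => /(_ isT isT).
  rewrite -(Rintegral_itv_bndo_bndc it1) -/mu FTC => E.
  by move: E; rewrite -/mu; lra.
have : h 1 - \int[mu]_(s in `[0, 1]) g s + \int[mu]_(s in `[0, t]) g s @[t --> (0 : R)^'+] -->
    h 1 - \int[mu]_(s in `[0, 1]) g s + 0.
  apply: cvgD; first exact: cvg_cst.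
  by apply/cvg_at_right_filter; exact: (parameterized_integral_cvg_left ltr01).
apply: cvg_trans; apply: near_eq_cvg; near=> t; rewrite [RHS]hE//.
by apply/andP; split; near: t; [exact: nbhs_right_gt|exact: nbhs_right_lt].
Unshelve. all: by end_near. Qed.

(** The difference quotient at 0 equals h(c) for some 0 < c < t, so it must tend to L as well. This
    converts the initial condition on the quotient into a limit of phi' at 0. *)
Lemma derive_at_right_eq (R : realType) (phi h : R -> R) (L l : R) :
  {within `[0, +oo[, continuous phi} ->
  (forall t : R, 0 < t -> is_derive t 1 phi (h t)) ->
  h t @[t --> (0 : R)^'+] --> L ->
  (t^-1 * (phi t - phi 0)) @[t --> (0 : R)^'+] --> l -> L = l.
Proof.
move=> cphi dphi hL; apply: cvg_unique => //.
apply/cvgrPdist_le => e e0.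
have /cvgrPdist_le /(_ _ e0) := hL; move=> [d /= d0 hd].
exists d => //= t td t0.
have [c] : exists2 c, c \in `]0, t[ & phi t - phi 0 = h c * (t - 0).
  apply: MVT => //; last exact: within_itvcy_cc.
  by move=> x; rewrite in_itv/= => /andP[x0 _]; exact: dphi.
rewrite in_itv/= => /andP[c0 ct] ->; rewrite subr0 mulrCA mulVf ?gt_eqF// mulr1.
apply: hd => //; move: td; rewrite /ball/= !sub0r !normrN !gtr0_norm//.
exact: lt_trans.
Qed.

Lemma integrable_scale (R : realType) (a b c : R) (f : R -> R) :
  lebesgue_measure.-integrable `]a, b[ (EFin \o f) ->
  lebesgue_measure.-integrable `]a, b[ (EFin \o (fun t => c * f t)).
Proof.
move=> fi; rewrite (_ : EFin \o _ = (fun t => c%:E * (EFin \o f) t)%E)//.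
exact: integrableZl.
Qed.

Lemma integrable_withinM (R : realType) (psi g : R -> R) (T : R) :
  {within `[0, T], continuous psi} ->
  lebesgue_measure.-integrable `]0, T[ (EFin \o g) ->
  lebesgue_measure.-integrable `]0, T[ (EFin \o (fun t => psi t * g t)).
Proof.
move=> cp ig; have [M [_ hM]] : bounded_set (psi @` `[0, T]).
  by apply: compact_bounded; apply: continuous_compact => //; exact: segment_compact.
rewrite (_ : EFin \o _ = ((EFin \o psi) \* (EFin \o g))%E)//.
apply: integrableMr => //.
  by apply/measurable_EFinP; exact: measurable_int (within_integrable_oo cp).
exists M; split; first exact: num_real.
move=> x Mx t /=; rewrite in_itv/= => /andP[t0 tT]; apply: hM => //.
by exists t => //=; rewrite in_itv/= !ltW.
Qed.

(** The two positivity hypotheses serve the two cases of [fracop]: exponential kernels for nu < 1,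
    the pointwise product for nu = 1. *)
Lemma fracop_energy (R : realType) (psi g : R -> R) (T nu : R) :
  0 < T -> 0 < nu -> nu <= 1 ->
  {within `[0, +oo[, continuous psi} ->
  lebesgue_measure.-integrable `]0, T[ (EFin \o g) ->
  (forall s : R, 0 < s -> {for s, continuous g}) ->
  (forall lam : R, 0 <= lam ->
    0 <= \int[lebesgue_measure]_(t in `]0, T[)
      (psi t * \int[lebesgue_measure]_(s in `]0, t[) (g s * expR (- (lam * (t - s)))))) ->
  0 <= \int[lebesgue_measure]_(t in `]0, T[) (psi t * g t) ->
  lebesgue_measure.-integrable `]0, T[ (EFin \o (fun t => psi t * fracop nu g t)) /\
  0 <= \int[lebesgue_measure]_(t in `]0, T[) (psi t * fracop nu g t).
Proof.
move=> T0 nu0 nu1 cpsi ig cg hexp h1.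
have cp := within_itvcy_cc (T := T) cpsi.
have [nuE|nuN1] := eqVneq nu 1.
  have -> : (fun t => psi t * fracop nu g t) = (fun t => psi t * g t).
    by apply/funext => t; rewrite /fracop nuE eqxx.
  by split => //; exact: integrable_withinM.
have [] := @fractional_energy R psi g T nu T0 nu0 _ cp ig cg hexp.
  by rewrite lt_neqAle nuN1.
set w := (X in EFin \o X) => iw w0.
pose c := (Gamma (1 - nu))^-1.
have c0 : 0 <= c by rewrite invr_ge0 Gamma_ge0.
have iZ : lebesgue_measure.-integrable `]0, T[ (fun t => c%:E * (EFin \o w) t)%E.
  exact: integrableZl.
have -> : (fun t => psi t * fracop nu g t) = (fun t => c * w t).
  by apply/funext => t; rewrite /fracop (negbTE nuN1) mulrCA.
by split; [exact: iZ|rewrite RintegralZl// mulr_ge0].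
Qed.

Lemma telegraph_bound_high (R : realType) (alpha k xi : R) (phi : R -> R) :
  2^-1 < alpha -> alpha <= 1 -> 0 < k -> xi != 0 ->
  telegraph_sol alpha k xi phi ->
  forall T : R, 0 <= T -> `|phi T| <= 1.
Proof.
move=> a0 a1 k0 xi0.
have alpha0 : 0 < alpha by lra.
have a21 : 1 < 2 * alpha by lra.
have a22 : 2 * alpha <= 2 by lra.
have b0 : 0 < 2 * alpha - 1 by lra.
have b1 : 2 * alpha - 1 <= 1 by lra.
move=> [cphi]; rewrite ceiln_eq2//.
move=> dphi cg ig eqn phi0 /(_ a0) phi'0 T.
rewrite le_eqVlt => /predU1P[<-|T0]; first by rewrite phi0 normr1.
set h := phi^`()%classic; set g := derive1n 2 phi.
have dh (s : R) : 0 < s -> is_derive s 1 phi (h s).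
  by move=> s0; apply: DeriveDef; [exact: (dphi 0%N)|rewrite -derive1E].
have dg (s : R) : 0 < s -> is_derive s 1 h (g s).
  by move=> s0; apply: DeriveDef; [exact: (dphi 1%N)|rewrite -derive1E].
have ch (s : R) : 0 < s -> {for s, continuous h}.
  by move=> /dg/@ex_derive/derivable1_diffP/differentiable_continuous.
have [L hL] := derive_at_right_limit dg cg (ig 1 ltr01).
have L0 := derive_at_right_eq cphi dh hL phi'0; rewrite L0 in hL.
(* The two-sided derivative of phi at 0 depends on its unconstrained values at negative times;
   prescribing 0 there makes psi continuous on [[0, +oo[]. *)
pose psi (t : R) := if 0 < t then h t else 0.
have psiE t : 0 < t -> psi t = h t by rewrite /psi => ->.
have psi0 : psi 0 = 0 by rewrite /psi ltxx.
have near_psi (s : R) : 0 < s -> \near s, h s = psi s.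
  move=> s0; have : \forall x \near s, 0 < x.
    by have /cvgr_gt := @cvg_id _ (nbhs s); exact.
  by apply: filterS => x x0; rewrite psiE.
have cpsi : {within `[0, +oo[, continuous psi}.
  apply/continuous_within_itvcyP; split.
    move=> x; rewrite in_itv/= andbT => x0.
    have := ch _ x0; rewrite /prop_for /continuous_at psiE//; apply: cvg_trans.
    by apply: near_eq_cvg; exact: near_psi.
  rewrite psi0; move: hL; apply: cvg_trans; apply: near_eq_cvg.
  by near=> t; rewrite psiE//; near: t; exact: nbhs_right_gt.
have dpsi (s : R) : 0 < s -> is_derive s 1 psi (g s).
  by move=> s0; apply: near_eq_is_derive (dg _ s0); exact: near_psi.
have cpsi_for s : 0 < s -> {for s, continuous psi} by exact: within_itvcy_for.
have cp := within_itvcy_cc (T := T) cpsi.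
have ip := within_integrable_oo cp.
pose mu := @lebesgue_measure R.
have [i1 e1] : mu.-integrable `]0, T[ (EFin \o (fun t => psi t * fracop alpha psi t)) /\
    0 <= \int[mu]_(t in `]0, T[) (psi t * fracop alpha psi t).
  apply: (fracop_energy T0 alpha0 a1 cpsi ip cpsi_for); first by move=> lam lam0; exact: exp_energy.
  by apply: Rintegral_ge0 => t _; exact: sqr_ge0.
(* Used for the pair (psi, phi''), where it settles the case 2 alpha - 1 = 1, and for (phi, psi),
   where it integrates the right-hand side of the equation. *)
have half_sqr (f f' : R -> R) : {within `[0, T], continuous f} ->
    (forall s : R, 0 < s -> is_derive s 1 f (f' s)) ->
    (forall s : R, 0 < s -> {for s, continuous f'}) ->
    mu.-integrable `]0, T[ (EFin \o (fun t => f t * f' t)) ->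
    \int[mu]_(t in `]0, T[) (f t * f' t) = f T ^+ 2 / 2 - f 0 ^+ 2 / 2.
  move=> cf df cf' iff.
  apply: (@FTC2_integrable _ (fun t => f t ^+ 2 / 2)) => //.
  - by apply: withinM; [exact: withinM|apply: continuous_subspaceT; exact: cst_continuous].
  - move=> t /andP[t0 _]; have dft := df _ t0.
    rewrite (_ : (fun t => _) = 2^-1 \*: (f ^+ 2)); last first.
      by apply/funext => x /=; rewrite mulrC.
    apply: is_derive_eq; rewrite /GRing.scale/= expr1; lra.
  - move=> t /andP[t0 tT]; apply: cvgM; last exact: cf'.
    by apply: (within_continuous_continuous T0 cf); rewrite in_itv/= t0.
have ipg : mu.-integrable `]0, T[ (EFin \o (fun t => psi t * g t)).
  by apply: integrable_withinM => //; exact: ig.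
have [i2 e2] : mu.-integrable `]0, T[ (EFin \o (fun t => psi t * fracop (2 * alpha - 1) g t)) /\
    0 <= \int[mu]_(t in `]0, T[) (psi t * fracop (2 * alpha - 1) g t).
  apply: (fracop_energy T0 b0 b1 cpsi (ig T T0) cg).
    by move=> lam lam0; exact: (exp_energy_derive cpsi T0 lam0 psi0 dpsi cg (ig T T0)).
  rewrite (half_sqr psi g cp dpsi cg ipg) psi0 expr0n/= mul0r subr0.
  by rewrite divr_ge0// sqr_ge0.
have cphiT := within_itvcy_cc (T := T) cphi.
have iphi : mu.-integrable `]0, T[ (EFin \o (fun t => phi t * psi t)).
  by apply: within_integrable_oo; exact: withinM.
have Ephi : \int[mu]_(t in `]0, T[) (phi t * psi t) = phi T ^+ 2 / 2 - phi 0 ^+ 2 / 2.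
  apply: (half_sqr phi psi cphiT _ cpsi_for iphi) => s s0; rewrite (psiE s s0); exact: dh.
have eqn' t : 0 < t -> k * (psi t * fracop alpha psi t) + psi t * fracop (2 * alpha - 1) g t =
    - xi ^+ 2 * (phi t * psi t).
  move=> t0; have -> : fracop alpha psi t = fracop alpha h t.
    rewrite /fracop psiE//; case: ifP => // _; congr (_ * _).
    by apply: eq_Rintegral => s; rewrite inE/= in_itv/= => /andP[s0 _]; rewrite psiE.
  have := eqn t t0; rewrite (caputo1E phi alpha0 a1) (caputo2E phi a21 a22) -/h -/g => E.
  rewrite [phi t * _]mulrC [RHS]mulrCA -E mulrDr; congr (_ + _); exact: mulrCA.
(* Adding the two energies and substituting the equation yields 0 <= - xi^2 (phi(T)^2 - 1) / 2,
   whence the bound after division by xi^2 > 0. *)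
have : 0 <= \int[mu]_(t in `]0, T[) (k * (psi t * fracop alpha psi t) + psi t * fracop (2 * alpha - 1) g t).
  have iZ : mu.-integrable `]0, T[ (EFin \o (fun t => k * (psi t * fracop alpha psi t))).
    exact: integrable_scale i1.
  rewrite (RintegralD _ iZ i2)// (RintegralZl _ _ i1)//.
  by apply: addr_ge0 e2; apply: mulr_ge0 e1; exact: ltW.
rewrite (@eq_Rintegral _ _ R mu _ (fun t => - xi ^+ 2 * (phi t * psi t))); last first.
  by move=> t; rewrite inE/= in_itv/= => /andP[t0 _]; exact: eqn'.
rewrite RintegralZl// Ephi phi0 mulNr oppr_ge0 pmulr_rle0 ?exprn_even_gt0//.
rewrite expr1n subr_le0 ler_pM2r ?invr_gt0// => le1.
have : `|phi T| ^+ 2 <= 1 by rewrite real_normK ?num_real.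
by rewrite -[leRHS](expr1n _ 2) ler_sqr ?nnegrE.
Unshelve. all: by end_near. Qed.

Lemma telegraph_bound (R : realType) (alpha k xi : R) (phi : R -> R) :
  0 < alpha -> alpha <= 1 -> 0 < k -> xi != 0 ->
  telegraph_sol alpha k xi phi ->
  forall T : R, 0 <= T -> `|phi T| <= 1.
Proof.
move=> a0 a1 k0 xi0 sol; have [ale|alt] := leP alpha 2^-1.
  exact: telegraph_bound_low sol.
exact: telegraph_bound_high sol.
Qed.

(** * The Fourier-Plancherel transform and the H1 norm *)

Section sqnorm.
Variable R : realType.
Implicit Types (z w : R[i]) (x : R).

Lemma complex_ReB z w : complex.Re (z - w) = complex.Re z - complex.Re w.
Proof. by case: z; case: w. Qed.

Lemma complex_ImB z w : complex.Im (z - w) = complex.Im z - complex.Im w.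
Proof. by case: z; case: w. Qed.

Lemma complex_ReM z w :
  complex.Re (z * w) = complex.Re z * complex.Re w - complex.Im z * complex.Im w.
Proof. by case: z; case: w. Qed.

Lemma complex_ImM z w :
  complex.Im (z * w) = complex.Re z * complex.Im w + complex.Im z * complex.Re w.
Proof. by case: z; case: w. Qed.

Lemma sqnorm_ge0 z : 0 <= sqnorm z.
Proof. by rewrite addr_ge0 ?sqr_ge0. Qed.

Lemma sqnormM_real z x : sqnorm (z * x%:C) = sqnorm z * x ^+ 2.
Proof. rewrite /sqnorm complex_ReM complex_ImM /=; ring. Qed.

(** By the parallelogram identity the difference of the two sides is |z + w|^2. *)
Lemma sqnormB_le z w : sqnorm (z - w) <= 2 * sqnorm z + 2 * sqnorm w.
Proof.
rewrite /sqnorm !complex_ReB !complex_ImB -subr_ge0.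
rewrite (_ : _ - _ = (complex.Re z + complex.Re w) ^+ 2 + (complex.Im z + complex.Im w) ^+ 2); last ring.
by rewrite addr_ge0 ?sqr_ge0.
Qed.

Lemma sqnorm_eq0 z : sqnorm z = 0 -> z = 0.
Proof.
case: z => a b /eqP; rewrite /sqnorm/= paddr_eq0 ?sqr_ge0// !sqrf_eq0.
by move=> /andP[/eqP-> /eqP->].
Qed.

End sqnorm.

Section fourier_transform.
Variable R : realType.
Local Notation mu := (@lebesgue_measure R).
Implicit Types g G : R -> R[i].

Definition cmeasurable g :=
  measurable_fun setT (fun x => complex.Re (g x)) /\
  measurable_fun setT (fun x => complex.Im (g x)).

Lemma cmeasurableB g1 g2 : cmeasurable g1 -> cmeasurable g2 -> cmeasurable (g1 \- g2).
Proof.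
move=> [r1 i1] [r2 i2]; split.
  rewrite (_ : (fun _ => _) = (fun x => complex.Re (g1 x)) \- (fun x => complex.Re (g2 x))).
    exact: measurable_funB.
  by apply/funext => x; rewrite /= complex_ReB.
rewrite (_ : (fun _ => _) = (fun x => complex.Im (g1 x)) \- (fun x => complex.Im (g2 x))).
  exact: measurable_funB.
by apply/funext => x; rewrite /= complex_ImB.
Qed.

Lemma measurable_sqnorm g : cmeasurable g -> measurable_fun setT (fun x => sqnorm (g x)).
Proof. by move=> [r i]; apply: measurable_funD; exact: measurable_funX. Qed.

Lemma measurable_esqnorm g : cmeasurable g -> measurable_fun setT (fun x => (sqnorm (g x))%:E).
Proof. by move=> mg; apply/measurable_EFinP; exact: measurable_sqnorm. Qed.

Lemma L2_cmeasurable g : L2 g -> cmeasurable g.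
Proof. by case. Qed.

(** A substitute for the L2 triangle inequality that avoids square roots; the factor 2 is harmless,
    as it is applied to finite quantities or to quantities tending to 0. *)
Lemma integral_sqnormB_le g1 g2 : cmeasurable g1 -> cmeasurable g2 ->
  (\int[mu]_x (sqnorm (g1 x - g2 x))%:E <=
   2%:E * \int[mu]_x (sqnorm (g1 x))%:E + 2%:E * \int[mu]_x (sqnorm (g2 x))%:E)%E.
Proof.
move=> m1 m2; have e1 := measurable_esqnorm m1; have e2 := measurable_esqnorm m2.
have p g x : (0 <= (sqnorm (g x))%:E)%E by rewrite lee_fin sqnorm_ge0.
rewrite -!ge0_integralZl// -ge0_integralD//.
- apply: ge0_le_integral => //.
  + by move=> x _; rewrite lee_fin sqnorm_ge0.
  + exact: (measurable_esqnorm (cmeasurableB m1 m2)).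
  + by apply: emeasurable_funD; exact: emeasurable_funM.
  + by move=> x _; rewrite -!EFinM -EFinD lee_fin sqnormB_le.
- by move=> x _; rewrite mule_ge0.
- exact: emeasurable_funM.
- by move=> x _; rewrite mule_ge0.
- exact: emeasurable_funM.
Qed.

Lemma L2B g1 g2 : L2 g1 -> L2 g2 -> L2 (g1 \- g2).
Proof.
move=> L1 L2; have [m1 m2] := cmeasurableB (L2_cmeasurable L1) (L2_cmeasurable L2).
split => //; apply: le_lt_trans (integral_sqnormB_le (L2_cmeasurable L1) (L2_cmeasurable L2)) _.
by case: L1 L2 => _ _ l1 [_ _ l2]; rewrite lte_add_pinfty// lte_mul_pinfty.
Qed.

Local Notation B N := (`[(- N%:R)%R, N%:R%R]%classic : set R).

(** On a bounded interval L2 embeds into L1, through |a| <= 1 + a^2 + b^2 and the integrability of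
    the constant 1 there. *)
Lemma L2_integrable_itv g N : L2 g ->
  mu.-integrable (B N) (EFin \o (fun x => complex.Re (g x))) /\
  mu.-integrable (B N) (EFin \o (fun x => complex.Im (g x))).
Proof.
move=> [mr mi ltg].
have i1 : mu.-integrable (B N) (EFin \o (fun x => 1 + sqnorm (g x))).
  rewrite (_ : EFin \o _ = cst 1%E \+ (fun x => (sqnorm (g x))%:E))//.
  apply: integrableD => //.
    have : mu.-integrable (B N) (EFin \o cst 1); last by [].
    apply: continuous_compact_integrable; first exact: segment_compact.
    by apply: continuous_subspaceT; exact: cst_continuous.
  apply: (@integrableS _ _ _ _ setT) => //.
  apply/integrableP; split; first exact: measurable_esqnorm.
  under eq_integral do rewrite gee0_abs ?lee_fin ?sqnorm_ge0//.
  exact: ltg.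
have bnd (a b : R) : `|a| <= 1 + (a ^+ 2 + b ^+ 2).
  have a2 : a ^+ 2 = `|a| ^+ 2 by rewrite real_normK ?num_real.
  rewrite a2; have := sqr_ge0 b; have := normr_ge0 a; have := sqr_ge0 (`|a| - 1); nra.
have s0 x : 0 <= 1 + sqnorm (g x) by apply: addr_ge0 => //; exact: sqnorm_ge0.
split; apply: le_integrable i1 => //.
- by apply/measurable_EFinP; exact: measurable_funTS.
- move=> x _; rewrite /= lee_fin [leRHS]ger0_norm ?s0//.
  exact: (bnd _ (complex.Im (g x))).
- by apply/measurable_EFinP; exact: measurable_funTS.
- move=> x _; rewrite /= lee_fin [leRHS]ger0_norm ?s0//.
  by rewrite /sqnorm [X in 1 + X]addrC bnd.
Qed.

Lemma integrable_normReIm g N : L2 g ->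
  mu.-integrable (B N) (EFin \o (fun x => `|complex.Re (g x)| + `|complex.Im (g x)|)).
Proof.
move=> Lg; have [iR iI] := L2_integrable_itv N Lg.
rewrite (_ : EFin \o _ = (fun x => `|(EFin \o (fun x => complex.Re (g x))) x| +
  `|(EFin \o (fun x => complex.Im (g x))) x|)%E)//.
by apply: integrableD => //; exact: integrable_abse.
Qed.

Lemma integrable_ReIm_bounded g N (c1 c2 : R -> R) : L2 g ->
  measurable_fun setT c1 -> measurable_fun setT c2 ->
  (forall x, `|c1 x| <= 1) -> (forall x, `|c2 x| <= 1) ->
  mu.-integrable (B N) (EFin \o (fun x => c1 x * complex.Re (g x) + c2 x * complex.Im (g x))).
Proof.
move=> Lg m1 m2 b1 b2; have [mr mi _] := Lg.
have iS := integrable_normReIm N Lg.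
apply: le_integrable iS => //.
  apply/measurable_EFinP; apply: measurable_funTS.
  by apply: measurable_funD; exact: measurable_funM.
move=> x _; rewrite /= lee_fin [leRHS]ger0_norm ?addr_ge0//.
by rewrite (le_trans (ler_normD _ _))// !normrM lerD// ler_piMl.
Qed.

Let expi (xi x : R) : R[i] := cos (xi * x) -i* sin (xi * x).

Let abs_cos (x : R) : `|cos x| <= 1.
Proof. by rewrite ler_norml cos_geN1 cos_le1. Qed.

Let abs_sin (x : R) : `|sin x| <= 1.
Proof. by rewrite ler_norml sin_geN1 sin_le1. Qed.

Let measurable_cosM (xi : R) : measurable_fun setT (fun x : R => cos (xi * x)).
Proof.
apply: continuous_measurable_fun => x.
apply: (@cvg_comp _ _ _ (fun x => xi * x) (@cos R)); last exact: continuous_cos.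
by apply: cvgM; [exact: cvg_cst|exact: cvg_id].
Qed.

Let measurable_sinM (xi : R) : measurable_fun setT (fun x : R => sin (xi * x)).
Proof.
apply: continuous_measurable_fun => x.
apply: (@cvg_comp _ _ _ (fun x => xi * x) (@sin R)); last exact: continuous_sin.
by apply: cvgM; [exact: cvg_cst|exact: cvg_id].
Qed.

Let measurable_NsinM (xi : R) : measurable_fun setT (fun x : R => - sin (xi * x)).
Proof. exact: measurableT_comp. Qed.

Let ReE g xi x : complex.Re (expi xi x * g x) =
  cos (xi * x) * complex.Re (g x) + sin (xi * x) * complex.Im (g x).
Proof. by rewrite complex_ReM /= mulNr opprK. Qed.

Let ImE g xi x : complex.Im (expi xi x * g x) =
  - sin (xi * x) * complex.Re (g x) + cos (xi * x) * complex.Im (g x).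
Proof. by rewrite complex_ImM /= addrC. Qed.

Let integrable_Re g N xi : L2 g ->
  mu.-integrable (B N) (EFin \o (fun x => complex.Re (expi xi x * g x))).
Proof.
move=> Lg; rewrite (funext (ReE g xi)).
exact: integrable_ReIm_bounded.
Qed.

Let integrable_Im g N xi : L2 g ->
  mu.-integrable (B N) (EFin \o (fun x => complex.Im (expi xi x * g x))).
Proof.
move=> Lg; rewrite (funext (ImE g xi)).
by apply: integrable_ReIm_bounded => // x; rewrite normrN.
Qed.

Lemma fourier_truncB g1 g2 N xi : L2 g1 -> L2 g2 ->
  fourier_trunc (g1 \- g2) N xi = fourier_trunc g1 N xi - fourier_trunc g2 N xi.
Proof.
move=> L1 L2; rewrite /fourier_trunc /cintegral.
have -> (a b c d : R) : (a +i* b) - (c +i* d) = (a - c) +i* (b - d) by [].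
rewrite -!RintegralB//; try exact: integrable_Re; try exact: integrable_Im.
congr (_ +i* _); apply: eq_Rintegral => x _.
  by rewrite -complex_ReB -mulrBr.
by rewrite -complex_ImB -mulrBr.
Qed.

Let continuous_param g N (p q : R -> R) : L2 g -> continuous p -> continuous q ->
  (forall x, `|p x| <= 1) -> (forall x, `|q x| <= 1) ->
  continuous (fun xi : R => \int[mu]_(x in B N)
    (p (xi * x) * complex.Re (g x) + q (xi * x) * complex.Im (g x))).
Proof.
move=> Lg cp cq p1 q1 xi; have [mr mi _] := Lg.
have iS := integrable_normReIm N Lg.
have cpM (r : R -> R) y : continuous r -> continuous (fun x : R => r (x * y)).
  move=> cr x; apply: (@cvg_comp _ _ _ (fun x => x * y) r); last exact: cr.
  by apply: cvgM; [exact: cvg_id|exact: cvg_cst].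
have mpM (r : R -> R) y : continuous r -> measurable_fun setT (fun x : R => r (y * x)).
  move=> cr; apply: continuous_measurable_fun => x.
  apply: (@cvg_comp _ _ _ (fun x => y * x) r); last exact: cr.
  by apply: cvgM; [exact: cvg_cst|exact: cvg_id].
have := @continuity_under_integral R _ _ mu
  (fun xi x => p (xi * x) * complex.Re (g x) + q (xi * x) * complex.Im (g x)) (B N)
  (measurable_itv _) (xi - 1) (xi + 1) _ _ _ iS _.
apply.
- move=> y _; apply: integrable_ReIm_bounded => //; exact: mpM.
- apply: aeW => x _ y _; apply: cvgD; apply: cvgM; try exact: cvg_cst.
    exact: cpM.
  exact: cpM.
- move=> y _; apply: aeW => x _.
  by rewrite (le_trans (ler_normD _ _))// !normrM lerD// ler_piMl.
- by rewrite inE/= in_itv/= ltrBlDr ltrDl ltr01.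
Qed.

(** The truncated transform is continuous in the frequency, by dominated convergence with majorant
    |Re g| + |Im g| on [[-N, N]]. Its measurability is what allows [integral_sqnormB_le] to be
    applied to it. *)
Lemma cmeasurable_trunc g N : L2 g -> cmeasurable (fourier_trunc g N).
Proof.
move=> Lg; split; apply: continuous_measurable_fun; rewrite /fourier_trunc /cintegral/=.
  rewrite (_ : (fun _ => _) = (fun xi : R => \int[mu]_(x in B N)
    (cos (xi * x) * complex.Re (g x) + sin (xi * x) * complex.Im (g x)))).
    apply: continuous_param => //; [exact: continuous_cos|exact: continuous_sin].
  by apply/funext => xi; apply: eq_Rintegral => x _; rewrite ReE.
rewrite (_ : (fun _ => _) = (fun xi : R => \int[mu]_(x in B N)
  ((- sin (xi * x)) * complex.Re (g x) + cos (xi * x) * complex.Im (g x)))).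
  apply: (@continuous_param g N (fun y => - sin y) cos) => //.
  - by move=> x; apply: cvgN; exact: continuous_sin.
  - exact: continuous_cos.
  - by move=> x; rewrite normrN.
by apply/funext => xi; apply: eq_Rintegral => x _; rewrite ImE.
Qed.

End fourier_transform.

Section fourier_H1.
Variable R : realType.
Local Notation mu := (@lebesgue_measure R).
Implicit Types g G : R -> R[i].

Lemma integral_sqnorm_ge0 (g : R -> R[i]) : (0 <= \int[mu]_x (sqnorm (g x))%:E)%E.
Proof. by apply: integral_ge0 => x _; rewrite lee_fin sqnorm_ge0. Qed.

Let cvg_sum2 (a b : nat -> \bar R) :
  a n @[n --> \oo] --> 0%E -> b n @[n --> \oo] --> 0%E ->
  (2%:E * a n + 2%:E * b n)%E @[n --> \oo] --> 0%E.
Proof.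
move=> a0 b0; rewrite -[X in _ --> X](adde0 0%E); apply: cvgeD => //.
  by rewrite -[X in _ --> X](mule0 2%:E); exact: cvgeZl.
by rewrite -[X in _ --> X](mule0 2%:E); exact: cvgeZl.
Qed.

Lemma is_fourierB g1 g2 G1 G2 : is_fourier g1 G1 -> is_fourier g2 G2 ->
  is_fourier (g1 \- g2) (G1 \- G2).
Proof.
move=> [Lg1 LG1 c1] [Lg2 LG2 c2]; split; [exact: L2B|exact: L2B|].
have m1 N := cmeasurableB (cmeasurable_trunc N Lg1) (L2_cmeasurable LG1).
have m2 N := cmeasurableB (cmeasurable_trunc N Lg2) (L2_cmeasurable LG2).
apply: (@squeeze_cvge _ _ _ _ (cst 0%E) _ _ _ _ _ (cvg_sum2 c1 c2)); last exact: cvg_cst.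
apply: nearW => N; rewrite integral_sqnorm_ge0/=.
apply: le_trans (integral_sqnormB_le (m1 N) (m2 N)).
rewrite le_eqVlt; apply/orP; left; apply/eqP; apply: eq_integral => xi _.
rewrite fourier_truncB//; congr (sqnorm _)%:E; rewrite /=; ring.
Qed.

(** The squared L2 distance of G1 and G2 is at most twice the sum of their squared distances to the
    truncated transforms, which tends to 0. *)
Lemma is_fourier_unique g G1 G2 : is_fourier g G1 -> is_fourier g G2 ->
  ae_eq mu setT G1 G2.
Proof.
move=> [Lg LG1 c1] [_ LG2 c2].
have mG := cmeasurableB (L2_cmeasurable LG1) (L2_cmeasurable LG2).
have m1 N := cmeasurableB (cmeasurable_trunc N Lg) (L2_cmeasurable LG1).
have m2 N := cmeasurableB (cmeasurable_trunc N Lg) (L2_cmeasurable LG2).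
have le0 : (\int[mu]_xi (sqnorm (G1 xi - G2 xi))%:E <= 0)%E.
  have cs := cvg_sum2 c1 c2; rewrite -(cvg_lim _ cs)//.
  apply: lime_ge; first by apply/cvg_ex; eexists; exact: cs.
  apply: nearW => N; rewrite addeC; apply: le_trans (integral_sqnormB_le (m2 N) (m1 N)).
  rewrite le_eqVlt; apply/orP; left; apply/eqP; apply: eq_integral => xi _.
  congr (sqnorm _)%:E; rewrite /=; ring.
have eq0 : (\int[mu]_xi `|(sqnorm (G1 xi - G2 xi))%:E| = 0)%E.
  under eq_integral do rewrite gee0_abs ?lee_fin ?sqnorm_ge0//.
  by apply/eqP; rewrite eq_le le0 integral_sqnorm_ge0.
have := (ae_eq_integral_abs mu measurableT (measurable_esqnorm mG)).1 eq0.
apply: filterS => xi /= /(_ I) [] h _; apply/eqP; rewrite -subr_eq0; apply/eqP.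
exact: sqnorm_eq0.
Qed.

Lemma is_fourier_fourier g G : is_fourier g G -> is_fourier g (fourier g).
Proof. by move=> gG; apply: (@xgetPex _ _ [set G | is_fourier g G]); exists G. Qed.

Definition H1sqr G : \bar R := \int[mu]_xi ((1 + xi ^+ 2) * sqnorm (G xi))%:E.

Lemma measurable_weight G : cmeasurable G ->
  measurable_fun setT (fun xi : R => ((1 + xi ^+ 2) * sqnorm (G xi))%:E).
Proof.
move=> mG; apply/measurable_EFinP; apply: measurable_funM; last exact: measurable_sqnorm.
by apply: measurable_funD => //; exact: measurable_funX.
Qed.

Lemma weight_ge0 G (xi : R) : 0 <= (1 + xi ^+ 2) * sqnorm (G xi).
Proof. by rewrite mulr_ge0 ?sqnorm_ge0// addr_ge0 ?sqr_ge0. Qed.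

Lemma H1sqr_ge0 G : (0 <= H1sqr G)%E.
Proof. by apply: integral_ge0 => xi _; rewrite lee_fin weight_ge0. Qed.

(** As [fourier] picks an arbitrary representative, almost everywhere uniqueness is needed to
    compute the norm from an explicit transform such as fourier f times E(t, .). *)
Lemma H1normE g G : is_fourier g G -> H1norm g = (H1sqr G `^ 2^-1)%E.
Proof.
move=> gG; have gF := is_fourier_fourier gG.
rewrite /H1norm /H1sqr; congr (_ `^ _)%E; apply: ae_eq_integral => //.
- by apply: measurable_weight; case: gF => _ /L2_cmeasurable.
- by apply: measurable_weight; case: gG => _ /L2_cmeasurable.
- by have := is_fourier_unique gF gG; apply: filterS => xi /= /[apply] ->.
Qed.

End fourier_H1.

(** * Continuity in time of bounded Fourier multipliers in the H1 norm *)

Section H1_multiplier.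
Variables (R : realType) (F : R -> R[i]) (E : R -> R -> R).
Local Notation mu := (@lebesgue_measure R).
Let G (t xi : R) : R[i] := F xi * (E t xi)%:C.

Hypothesis mF : cmeasurable F.
Hypothesis mG : forall t, 0 <= t -> cmeasurable (G t).
Hypothesis F_H1 : (H1sqr F < +oo)%E.
Hypothesis E_bound : forall t xi, 0 <= t -> xi != 0 -> `|E t xi| <= 1.

Let ae_neq0 : {ae mu, forall xi : R, xi != 0}.
Proof.
exists [set 0]; split => //=; first exact: lebesgue_measure_set1.
by move=> xi /= /negP; rewrite negbK => /eqP.
Qed.

Lemma H1sqr_multiplier_lty (t : R) : 0 <= t -> (H1sqr (G t) < +oo)%E.
Proof.
move=> t0; apply: le_lt_trans F_H1; apply: ae_ge0_le_integral => //.
- by move=> xi _; rewrite lee_fin weight_ge0.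
- by apply: measurable_weight; exact: mG.
- by move=> xi _; rewrite lee_fin weight_ge0.
- exact: measurable_weight.
- apply: filterS ae_neq0; first exact: (ae_filter_ringOfSetsType mu).
  move=> xi xi0 _; rewrite lee_fin ler_wpM2l ?addr_ge0 ?sqr_ge0//.
  rewrite sqnormM_real ler_piMr ?sqnorm_ge0//.
  by rewrite -real_normK ?num_real// exprn_ile1// E_bound.
Qed.

Hypothesis E_continuous : forall xi, {within `[0, +oo[, continuous (E ^~ xi)}.

Let D (s t xi : R) := G t xi - G s xi.

(** The constant 4 is 2 + 2, from [sqnormB_le] with |E| <= 1 at both times. *)
Let D_le (s t xi : R) : 0 <= s -> 0 <= t -> xi != 0 -> 
  (1 + xi ^+ 2) * sqnorm (D s t xi) <= 4 * ((1 + xi ^+ 2) * sqnorm (F xi)).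
Proof.
move=> s0 t0 xi0; rewrite [leRHS]mulrCA ler_wpM2l ?addr_ge0 ?sqr_ge0//.
apply: (le_trans (sqnormB_le _ _)); rewrite !sqnormM_real.
have E2 r : 0 <= r -> sqnorm (F xi) * E r xi ^+ 2 <= sqnorm (F xi).
  move=> r0; rewrite ler_piMr ?sqnorm_ge0//.
  by rewrite -real_normK ?num_real// exprn_ile1// E_bound.
by have := E2 s s0; have := E2 t t0; lra.
Qed.

Let integrable_dom : mu.-integrable setT (fun xi : R => (4 * ((1 + xi ^+ 2) * sqnorm (F xi)))%:E).
Proof.
have iF : mu.-integrable setT (fun xi : R => ((1 + xi ^+ 2) * sqnorm (F xi))%:E).
  apply/integrableP; split; first exact: measurable_weight.
  under eq_integral do rewrite gee0_abs ?lee_fin ?weight_ge0//.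
  exact: F_H1.
by under eq_fun do rewrite EFinM; exact: integrableZl.
Qed.

Lemma H1sqr_multiplier_cvg (s : R) : 0 <= s ->
  H1sqr (G t \- G s) @[t --> within `[0, +oo[ (nbhs s)] --> 0%E.
Proof.
(* Clipping at 0 extends the time variable to all of R, so that the limit along [[0, +oo[] can be
   tested on arbitrary real sequences, the form in which dominated convergence applies. As s >= 0,
   clipping does not increase the distance to s. *)
move=> s0; pose tm (t : R) := Num.max t 0.
have tm0 t : 0 <= tm t by rewrite le_max lexx orbT.
have mD t : 0 <= t -> cmeasurable (D s t) by move=> t0; apply: cmeasurableB; exact: mG.
have fin t : 0 <= t -> H1sqr (D s t) \is a fin_num.
  move=> t0; rewrite ge0_fin_numE ?H1sqr_ge0//.
  have /integrableP[_] := integrable_dom; apply: le_lt_trans.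
  apply: ae_ge0_le_integral => //.
  - by move=> xi _; rewrite lee_fin weight_ge0.
  - by apply: measurable_weight; exact: mD.
  - apply: measurableT_comp => //; exact: measurable_int integrable_dom.
  - apply: filterS ae_neq0; first exact: (ae_filter_ringOfSetsType mu).
  move=> xi xi0 _; rewrite gee0_abs.
      by rewrite lee_fin; exact: D_le.
    by rewrite lee_fin mulr_ge0// weight_ge0.
have cvg_seq (u : nat -> R) : u n @[n --> \oo] --> s ->
    H1sqr (D s (tm (u n))) @[n --> \oo] --> 0%E.
  move=> us.
  have tms0 : tm (u n) @[n --> \oo] --> s.
    apply/cvgrPdist_le => e e0; move/cvgrPdist_le : us => /(_ _ e0).
    apply: filterS => n; apply: le_trans; rewrite /tm; case: (leP (u n) 0) => // un0.
    by rewrite subr0 !ger0_norm ?subr_ge0 ?(le_trans un0)// lerDl oppr_ge0.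
  have tms : tm (u n) @[n --> \oo] --> within `[0, +oo[ (nbhs s).
    move=> P sP.
    have hP : \forall n \near \oo, tm (u n) \in `[0, +oo[ -> P (tm (u n)) := tms0 _ sP.
    suff : \forall n \near \oo, P (tm (u n)) by [].
    by apply: filterS hP => n; apply; rewrite in_itv/= andbT; exact: tm0.
  pose f_ (n : nat) (xi : R) : \bar R := ((1 + xi ^+ 2) * sqnorm (D s (tm (u n)) xi))%:E.
  have f_cvg (xi : R) : f_ ^~ xi @ \oo --> 0%E.
    have cE : E (tm (u n)) xi @[n --> \oo] --> E s xi.
      have /subspace_continuousP := @E_continuous xi.
      move=> /(_ s); rewrite /= in_itv/= andbT => /(_ s0); exact: cvg_comp.
    pose w := (1 + xi ^+ 2) * sqnorm (F xi).
    (* G t - G s = F (E t - E s): the frequency weight and F stay fixed, and only the scalar factor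
       depends on n. *)
    have -> : f_ ^~ xi = EFin \o (fun n => w * ((E (tm (u n)) xi - E s xi) * (E (tm (u n)) xi - E s xi))).
      apply/funext => n; rewrite /f_ /= /D /G -mulrBr -raddfB sqnormM_real expr2.
      by rewrite mulrA.
    have d0 : E (tm (u n)) xi - E s xi @[n --> \oo] --> 0.
      by rewrite -[X in _ --> X](subrr (E s xi)); apply: cvgB; [exact: cE|exact: cvg_cst].
    apply: cvg_EFin; first exact: nearW.
    have := cvgM (cvg_cst w) (cvgM d0 d0); rewrite !mulr0; exact.
  have [] := @dominated_convergence _ _ R mu setT measurableT f_ (cst 0%E) _ _ _ _ integrable_dom _.
  - by move=> n; apply: measurable_weight; exact: mD.
  - by [].
  - by apply: aeW => xi _; exact: f_cvg.
  - apply: filterS ae_neq0; first exact: (ae_filter_ringOfSetsType mu).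
    move=> xi xi0 n _; rewrite gee0_abs; last by rewrite lee_fin weight_ge0.
    by rewrite lee_fin; exact: D_le.
  by move=> _ _; rewrite integral0.
(* The sequential criterion is applied to a real function on the line; on [[0, +oo[] it agrees with
   the original quantity, since there [tm t] = t and the value is finite. *)
pose r t := fine (H1sqr (D s (tm t))).
have r_cvg : r t @[t --> s] --> 0.
  by apply/(@cvg_nbhsP _ R^o) => u us; exact: fine_cvg (cvg_seq u us).
have : (r t)%:E @[t --> within `[0, +oo[ (nbhs s)] --> 0%E.
  apply: cvg_EFin; first exact: nearW.
  by apply: cvg_within_filter; exact: r_cvg.
apply: cvg_trans; apply: near_eq_cvg.
rewrite near_withinE; apply: nearW => t; rewrite /= in_itv/= andbT => t0.
rewrite /r fineK; last exact: fin.
by rewrite /tm max_l.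
Qed.

End H1_multiplier.

(** The square root is continuous at 0; passing through [fine] is possible because convergence to 0
    forces the values to be eventually finite. *)
Lemma H1normB_cvg (R : realType) (T : Type) (A : set_system T) (g : T -> R -> R[i])
    (h : T -> R -> R[i]) : Filter A ->
  (\forall t \near A, is_fourier (g t) (h t)) ->
  H1sqr (h t) @[t --> A] --> 0%E -> H1norm (g t) @[t --> A] --> 0%E.
Proof.
move=> FA gh h0.
have fin : \forall t \near A, H1sqr (h t) \is a fin_num.
  by have /fine_cvgP[] := h0.
have r0 : fine (H1sqr (h t)) `^ 2^-1 @[t --> A] --> (0 : R).
  apply: cvg_powR0 => //; first by apply: nearW => t; rewrite fine_ge0// H1sqr_ge0.
  exact: fine_cvg h0.
have : (fine (H1sqr (h t)) `^ 2^-1)%:E @[t --> A] --> 0%E.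
  by apply: cvg_EFin; [exact: nearW|exact: r0].
apply: cvg_trans; apply: near_eq_cvg; apply: filterS2 gh fin => t ght ft.
by rewrite (H1normE ght) -[in RHS](fineK ft).
Qed.

Theorem lemma1 (R : realType) (alpha sigma eta : R)
  (alpha_gt0 : 0 < alpha) (alpha_le1 : alpha <= 1)
  (sigma_gt0 : 0 < sigma) (eta_gt0 : 0 < eta)
  (E : R -> R -> R)
  (E_sol : forall xi : R,
     telegraph_sol alpha (sigma / eta) xi (fun t : R => E t xi))
  (f : R -> R[i]) (f_H1 : H1 f)
  (v : R -> R -> R[i])
  (v_fourier : forall t : R, 0 <= t ->
     is_fourier (v t) (fun xi : R => fourier f xi * (E t xi)%:C)) :
  [/\ forall t : R, 0 <= t -> H1 (v t),
      forall s : R, 0 <= s ->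
        H1norm (v t \- v s) @[t --> within `[0, +oo[ (nbhs s)] --> 0%E
    & H1norm (v t \- f) @[t --> 0^'+] --> 0%E].
Proof.
have [f_fourier f_lty] := f_H1.
have mF : cmeasurable (fourier f) by case: f_fourier => _ /L2_cmeasurable.
have F_lty : (H1sqr (fourier f) < +oo)%E.
  by move: f_lty; rewrite /H1norm; apply: lty_poweRy; rewrite invr_eq0.
pose G t xi := fourier f xi * (E t xi)%:C.
(* Measurability in xi comes from [v_fourier]: being a transform includes membership in L2. *)
have mG t : 0 <= t -> cmeasurable (G t).
  by move=> /v_fourier[_ /L2_cmeasurable].
have E_bound t xi : 0 <= t -> xi != 0 -> `|E t xi| <= 1.
  move=> t0 xi0.
  exact: (telegraph_bound alpha_gt0 alpha_le1 (divr_gt0 sigma_gt0 eta_gt0) xi0 (E_sol xi)).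
have E_cont xi : {within `[0, +oo[, continuous (E ^~ xi)}.
  exact: tsol_continuous (E_sol xi).
(* Here [g] is any inverse transform of [G s]: it is taken to be [v s] for continuity at s, and [f]
   for the initial condition. *)
have vB_cvg g s : 0 <= s -> is_fourier g (G s) ->
    H1norm (v t \- g) @[t --> within `[0, +oo[ (nbhs s)] --> 0%E.
  move=> s0 gG; apply: (@H1normB_cvg _ _ _ _ (fun t => G t \- G s)).
    rewrite near_withinE; apply: nearW => t; rewrite /= in_itv/= andbT => t0.
    exact: is_fourierB (v_fourier t t0) gG.
  exact: H1sqr_multiplier_cvg.
split.
- move=> t t0; split; first exact: is_fourier_fourier (v_fourier t t0).
  rewrite (H1normE (v_fourier t t0)); apply: poweR_lty.
  exact: (H1sqr_multiplier_lty mF mG F_lty E_bound).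
- by move=> s s0; exact: vB_cvg (v_fourier s s0).
(* Since E(0, xi) = 1, [G 0] is the transform of [f] itself, so the limit is taken against [f]
   without identifying [v 0] with [f] pointwise. *)
- have fG : is_fourier f (G 0).
    rewrite (_ : G 0 = fourier f)//; apply/funext => xi.
    by rewrite /G (tsol_init (E_sol xi)) mulr1.
  have := vB_cvg f 0 (lexx _) fG; apply: cvg_trans; apply: cvg_app.
  by apply: within_subset => t; rewrite /= in_itv/= andbT; exact: ltW.
Qed.
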